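(* Let $(T^2,g)$ be a Riemannian $2$-torus. The Hessian form of the bienergy functional $E_2$ (on unit vector fields) is positive semi-definite at every critical point $V$ of $E_2$; that is, if $V$ is a biharmonic unit vector field on $(T^2,g)$, then $\frac{d^2}{dt^2}\{E_2(X(t))\}_{t=0}\ge0$ for all $C^\infty$ variations $X(t)$ ($t\in(-\epsilon,\epsilon)$, $\epsilon>0$) of $V=X(0)$ through unit vector fields on $(T^2,g)$.
   Context: For a compact Riemannian manifold $(M,g)$ with Levi-Civita connection $\nabla$ and curvature $R(X,Y)Z=\nabla_X\nabla_YZ-\nabla_Y\nabla_XZ-\nabla_{[X,Y]}Z$, a local orthonormal frame $\{e_i\}$ and a smooth unit vector field $V$, set $\bar\Delta V=\sum_i(\nabla_{\nabla_{e_i}e_i}V-\nabla_{e_i}\nabla_{e_i}V)$, $S(V)=\sum_iR(\nabla_{e_i}V,V)e_i$ and $E_2(V)=\frac12\int_M\{g(S(V),S(V))+g(\bar\Delta V,\bar\Delta V)-g(\bar\Delta V,V)^2\}v_g$. $V$ is a biharmonic unit vector field (a critical point of $E_2$) if the first derivative of $E_2$ vanishes along all smooth variations of $V$ through unit vector fields. The torus is $T^2=\mathbb{R}^2/\Gamma$ for a lattice $\Gamma$, with $g$ an arbitrary Riemannian metric. *)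

(* Defs.v *)
From Stdlib Require Import Reals Lra.
From Coquelicot Require Import Coquelicot.
Open Scope R_scope.

(* Functions, metrics and vector fields on the torus R^2/Gamma are represented
   by their Gamma-periodic lifts to R^2; a tangent vector is given by its
   components in the global coordinate frame (d/dx, d/dy), which is invariant
   under translations and hence descends to the torus. *)

Definition dir_derive {E : NormedModule R_AbsRing} (v : E) (f : E -> R) (p : E) : R :=
  Derive (fun s : R => f (plus p (scal s v))) 0.

(* [D] is meant to be open.  On a finite-dimensional space this is the usual
   C^n: all iterated directional derivatives of order at most n exist and are
   continuous on [D]. *)
Fixpoint C_n {E : NormedModule R_AbsRing} (n : nat) (D : E -> Prop) (f : E -> R) : Prop :=
  (forall p, D p -> continuous f p) /\
  match n with
  | O => True
  | S m => forall v : E,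
      (forall p, D p -> ex_derive (fun s : R => f (plus p (scal s v))) 0) /\
      C_n m D (dir_derive v f)
  end.

Definition smooth_on {E : NormedModule R_AbsRing} (D : E -> Prop) (f : E -> R) : Prop :=
  forall n, C_n n D f.

Definition plane : Type := (R * R)%type.

Inductive ix : Set := I1 | I2.

Definition sum2 (f : ix -> R) : R := f I1 + f I2.

Definition coord (i : ix) (v : plane) : R :=
  match i with I1 => fst v | I2 => snd v end.

Definition vec (f : ix -> R) : plane := (f I1, f I2).

Definition field : Type := plane -> plane.

Definition partial (i : ix) (f : plane -> R) (p : plane) : R :=
  match i with
  | I1 => Derive (fun x => f (x, snd p)) (fst p)
  | I2 => Derive (fun y => f (fst p, y)) (snd p)
  end.

Definition smooth (f : plane -> R) : Prop :=
  smooth_on (E := prod_NormedModule R_AbsRing R_NormedModule R_NormedModule)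
    (fun _ => True) f.

Definition smooth_field (V : field) : Prop :=
  forall i, smooth (fun p => coord i (V p)).

Definition cross (a b : plane) : R := fst a * snd b - snd a * fst b.

Definition comb (a b : plane) (s t : R) : plane :=
  (s * fst a + t * fst b, s * snd a + t * snd b).

Definition lattice (a b v : plane) : Prop :=
  exists m n : Z, v = comb a b (IZR m) (IZR n).

Definition periodic {T : Type} (a b : plane) (f : plane -> T) : Prop :=
  forall v p : plane, lattice a b v -> f (plus p v) = f p.

Definition metric : Type := ix -> ix -> plane -> R.

Definition inner (g : metric) (p u v : plane) : R :=
  sum2 (fun i => sum2 (fun j => g i j p * coord i u * coord j v)).

Definition riemannian (a b : plane) (g : metric) : Prop :=
  (forall i j, smooth (g i j)) /\
  (forall i j, periodic a b (g i j)) /\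
  (forall i j p, g i j p = g j i p) /\
  (forall p v, v <> (0, 0) -> 0 < inner g p v v).

Definition det (g : metric) (p : plane) : R :=
  g I1 I1 p * g I2 I2 p - g I1 I2 p * g I2 I1 p.

Definition ginv (g : metric) (i j : ix) (p : plane) : R :=
  match i, j with
  | I1, I1 => g I2 I2 p / det g p
  | I1, I2 => - g I1 I2 p / det g p
  | I2, I1 => - g I2 I1 p / det g p
  | I2, I2 => g I1 I1 p / det g p
  end.

(* Gamma^k_ij of the Levi-Civita connection. *)
Definition christoffel (g : metric) (k i j : ix) (p : plane) : R :=
  / 2 * sum2 (fun l => ginv g k l p *
    (partial i (g j l) p + partial j (g i l) p - partial l (g i j) p)).

Definition nabla (g : metric) (X Y : field) : field := fun p =>
  vec (fun k => sum2 (fun i => coord i (X p) *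
    (partial i (fun q => coord k (Y q)) p +
     sum2 (fun j => christoffel g k i j p * coord j (Y p))))).

Definition lie_bracket (X Y : field) : field := fun p =>
  vec (fun k => sum2 (fun i =>
    coord i (X p) * partial i (fun q => coord k (Y q)) p -
    coord i (Y p) * partial i (fun q => coord k (X q)) p)).

Definition curvature (g : metric) (X Y Z : field) : field := fun p =>
  minus (minus (nabla g X (nabla g Y Z) p) (nabla g Y (nabla g X Z) p))
        (nabla g (lie_bracket X Y) Z p).

(* The orthonormal frame obtained from (d/dx, d/dy) by Gram-Schmidt.  It is
   globally defined on the torus, and the operators below, being traces, do not
   depend on which orthonormal frame is used. *)
Definition frame (g : metric) (i : ix) : field := fun p =>
  match i with
  | I1 => (/ sqrt (g I1 I1 p), 0)
  | I2 => (- g I1 I2 p / sqrt (g I1 I1 p * det g p),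
           g I1 I1 p / sqrt (g I1 I1 p * det g p))
  end.

Lemma det_pos a b g p : riemannian a b g -> 0 < g I1 I1 p /\ 0 < det g p.
Proof.
intros (_ & _ & sym & pos).
assert (H1 : 0 < g I1 I1 p).
{ assert (H := pos p (1, 0)). unfold inner, sum2, coord in H; simpl in H.
  assert (K : (1, 0) <> (0, 0)) by (intros E; injection E; lra).
  specialize (H K). lra. }
split; [exact H1|].
assert (H := pos p (- g I1 I2 p, g I1 I1 p)).
assert (K : (- g I1 I2 p, g I1 I1 p) <> (0, 0)) by (intros E; injection E; lra).
specialize (H K). unfold inner, sum2, coord in H; simpl in H.
unfold det. rewrite (sym I2 I1 p) in *.
apply Rmult_lt_reg_l with (g I1 I1 p); [exact H1|]. nra.
Qed.

Lemma frame_orthonormal a b g p i j : riemannian a b g ->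
  inner g p (frame g i p) (frame g j p) =
  match i, j with I1, I1 | I2, I2 => 1 | _, _ => 0 end.
Proof.
intros hg. destruct (det_pos a b g p hg) as [h1 hd].
destruct hg as (_ & _ & sym & _).
assert (hm := Rmult_lt_0_compat _ _ h1 hd).
assert (s1 := sqrt_lt_R0 _ h1). assert (s2 := sqrt_lt_R0 _ hm).
assert (q1 := sqrt_sqrt _ (Rlt_le _ _ h1)).
assert (q2 := sqrt_sqrt _ (Rlt_le _ _ hm)).
unfold inner, sum2, coord, frame.
set (u := sqrt (g I1 I1 p)) in *.
set (w := sqrt (g I1 I1 p * det g p)) in *.
destruct i, j; simpl; rewrite ?(sym I2 I1 p).
- rewrite <- q1. field. lra.
- field. lra.
- field. lra.
- replace 1 with (w * w / (w * w)) by (field; lra).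
  rewrite q2 at 1. unfold det. rewrite (sym I2 I1 p). field. lra.
Qed.

Lemma partial_ext i f h p : (forall q, f q = h q) -> partial i f p = partial i h p.
Proof. intros H; destruct i; apply Derive_ext; intros; apply H. Qed.

(* The next two lemmas say that the connection [nabla] is torsion-free and
   compatible with [g]. *)
Lemma christoffel_sym a b g k i j p : riemannian a b g ->
  christoffel g k i j p = christoffel g k j i p.
Proof.
intros (_ & _ & sym & _). unfold christoffel, sum2.
rewrite !(partial_ext _ (g i j) (g j i) p (sym i j)). ring.
Qed.

Lemma christoffel_metric a b g i j k p : riemannian a b g ->
  partial k (g i j) p =
  sum2 (fun l => christoffel g l k i p * g l j p + christoffel g l k j p * g i l p).
Proof.
intros hg. destruct (det_pos a b g p hg) as [h1 hd].
destruct hg as (_ & _ & sym & _).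
unfold christoffel, sum2, ginv.
assert (E := fun m => partial_ext m (g I2 I1) (g I1 I2) p (sym I2 I1)).
unfold det in *. rewrite (sym I2 I1 p) in hd.
destruct i, j, k; rewrite ?E, ?(sym I2 I1 p); field; lra.
Qed.

Definition rough_laplacian (g : metric) (V : field) : field := fun p =>
  vec (fun k => sum2 (fun i => coord k (minus
    (nabla g (nabla g (frame g i) (frame g i)) V p)
    (nabla g (frame g i) (nabla g (frame g i) V) p)))).

Definition S_field (g : metric) (V : field) : field := fun p =>
  vec (fun k => sum2 (fun i => coord k
    (curvature g (nabla g (frame g i) V) V (frame g i) p))).

(* Integral over the torus against the Riemannian measure sqrt(det g) dx dy,
   computed on the fundamental parallelogram {s a + t b | 0 <= s, t <= 1}; the
   factor |cross a b| is the Jacobian of (s, t) |-> s a + t b. *)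
Definition torus_integral (a b : plane) (g : metric) (f : plane -> R) : R :=
  RInt (fun s => RInt (fun t =>
    f (comb a b s t) * sqrt (det g (comb a b s t)) * Rabs (cross a b)) 0 1) 0 1.

Definition bienergy (a b : plane) (g : metric) (V : field) : R :=
  / 2 * torus_integral a b g (fun p =>
    inner g p (S_field g V p) (S_field g V p) +
    inner g p (rough_laplacian g V p) (rough_laplacian g V p) -
    (inner g p (rough_laplacian g V p) (V p)) ^ 2).

Definition unit_field (a b : plane) (g : metric) (V : field) : Prop :=
  smooth_field V /\ periodic a b V /\ forall p, inner g p (V p) (V p) = 1.

(* Only the values [X t] with |t| < eps matter; smoothness is joint in (t, p). *)
Definition unit_variation (a b : plane) (g : metric) (V : field)
    (eps : R) (X : R -> field) : Prop :=
  (forall i, smooth_on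
     (E := prod_NormedModule R_AbsRing R_NormedModule
             (prod_NormedModule R_AbsRing R_NormedModule R_NormedModule))
     (fun q => Rabs (fst q) < eps) (fun q => coord i (X (fst q) (snd q)))) /\
  (forall t, Rabs t < eps -> unit_field a b g (X t)) /\
  (forall p, X 0 p = V p).

Definition biharmonic_unit (a b : plane) (g : metric) (V : field) : Prop :=
  unit_field a b g V /\
  forall (eps : R) (X : R -> field), 0 < eps -> unit_variation a b g V eps X ->
    is_derive (fun t => bienergy a b g (X t)) 0 0.

(* Main.v *)
(* In an oriented orthonormal frame a unit field V is an angle, and
   nabla_k V = alpha_k J V for a 1-form alpha.  The Laplacian satisfies
   g(Delta V, Delta V) - g(Delta V, V)^2 = (div alpha)^2, and S(V) is a fixed
   linear function of alpha, so E_2(V) is half a positive semi-definite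
   quadratic form q in alpha.  Along a variation X of V with angular speed phi,
   alpha changes by d(phi), whence E_2' = q(alpha, d phi) and, at t = 0,
   E_2'' = q(d phi, d phi) + q(alpha, d phi').  The second term is the first
   derivative of E_2 along the rotation of V by the angle t phi', which vanishes
   by criticality.  Working with alpha = g(nabla V, J V) and phi = g(X', J X),
   both polynomial in the field, avoids lifting the angle. *)
Require Import Defs.
From Stdlib Require Import Reals Lra ClassicalEpsilon FunctionalExtensionality.
From Coquelicot Require Import Coquelicot.
Open Scope R_scope.

(** * Calculus of smooth functions *)

(** The angle itself need not be periodic, but the Hessian only sees its time derivatives, which
    are; this is why rotation by t phi' is admissible on the torus. Dimension two enters twice.
    Vectors orthogonal to X are multiples of J X, so X' and nabla_k X are parallel and the term
    area(X', nabla_k X) drops out of the derivative of alpha; no curvature term appears either, as g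
    does not depend on t. And R(Y, Z) is area(Y, Z) times one fixed endomorphism, so S(V) reads off
    the numbers alpha(e_i) with coefficients independent of V; the Gauss curvature is never
    introduced. All identities hold between densities at each point. Integrals are only
    differentiated in t, added and compared with 0, and there is no integration by parts. The
    analytic cost lies in the notion of smoothness: it is given by iterated directional derivatives,
    so closure properties, symmetry of mixed derivatives and differentiation under the double
    integral are derived from that definition. *)

Lemma continuous_pair {U A B : UniformSpace} (f : U -> A) (h : U -> B) (x : U) :
  continuous f x -> continuous h x -> continuous (fun u => (f u, h u)) x.
Proof.
intros cf ch. apply (continuous_comp_2 f h pair); auto.
apply continuous_ext with (fun z => z); [intros []; reflexivity | apply continuous_id].
Qed.

Lemma line_continuous {E : NormedModule R_AbsRing} (p v : E) (s : R) :
  continuous (fun s : R => plus p (scal s v)) s.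
Proof.
apply (continuous_plus (fun _ => p)); [apply continuous_const|].
apply (continuous_scal (fun s : R => s) (fun _ => v));
  [apply continuous_id | apply continuous_const].
Qed.

Lemma line_0 {E : NormedModule R_AbsRing} (p v : E) : plus p (scal 0 v) = p.
Proof.
rewrite (scal_zero_l (K := R_AbsRing) v : scal 0 v = zero). apply plus_zero_r.
Qed.

Lemma locally_line {E : NormedModule R_AbsRing} (D : E -> Prop) (p v : E) (s : R) :
  open D -> D (plus p (scal s v)) -> locally s (fun r : R => D (plus p (scal r v))).
Proof. intros oD Dp. exact (line_continuous p v s D (oD _ Dp)). Qed.

Lemma locally_line_0 {E : NormedModule R_AbsRing} (D : E -> Prop) (p v : E) :
  open D -> D p -> locally 0 (fun r : R => D (plus p (scal r v))).
Proof. intros oD Dp. apply locally_line; [exact oD|]. rewrite line_0. exact Dp. Qed.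

Lemma dir_derive_ext {E : NormedModule R_AbsRing} (D : E -> Prop) (f h : E -> R) (v p : E) :
  open D -> (forall q, D q -> f q = h q) -> D p -> dir_derive v f p = dir_derive v h p.
Proof.
intros oD e Dp. apply Derive_ext_loc.
apply filter_imp with (2 := locally_line_0 D p v oD Dp). auto.
Qed.

(** Openness keeps a short segment through each point inside [D], so derivatives on [D] depend only
    on the values there. The inductions below use this to substitute formulas for derivatives that
    are known on [D] only. *)
Lemma C_n_ext {E : NormedModule R_AbsRing} (D : E -> Prop) (n : nat) : open D ->
  forall f h : E -> R, (forall q, D q -> f q = h q) -> C_n n D f -> C_n n D h.
Proof.
intros oD. induction n as [|n IH]; intros f h e [cf df]; split.
1, 3: intros p Dp; apply continuous_ext_loc with f; [|now apply cf];
  apply filter_imp with (2 := oD p Dp); intros; now apply e.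
- exact I.
- intros v. destruct (df v) as [ef Cf]. split.
  + intros p Dp. apply ex_derive_ext_loc with (2 := ef p Dp).
    apply filter_imp with (2 := locally_line_0 D p v oD Dp). auto.
  + apply IH with (2 := Cf). intros q Dq. now apply dir_derive_ext with D.
Qed.

Lemma C_n_S {E : NormedModule R_AbsRing} (D : E -> Prop) (n : nat) :
  forall f : E -> R, C_n (S n) D f -> C_n n D f.
Proof.
induction n as [|n IH]; intros f [cf df]; split; auto.
intros v. destruct (df v) as [ef Cf]. split; auto.
Qed.

Lemma C_n_0 {E : NormedModule R_AbsRing} (D : E -> Prop) (n : nat) (f : E -> R) :
  C_n n D f -> forall p, D p -> continuous f p.
Proof. destruct n; intros []; auto. Qed.

Lemma C_n_const {E : NormedModule R_AbsRing} (D : E -> Prop) (n : nat) (c : R) :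
  open D -> C_n n D (fun _ => c).
Proof.
intros oD. revert c; induction n as [|n IH]; intros c; split.
1, 3: intros; apply continuous_const.
- exact I.
- intros v; split; [intros; apply ex_derive_const|].
  apply (C_n_ext D n oD (fun _ => 0)); [|apply IH].
  intros; symmetry; apply (Derive_const c).
Qed.

Lemma C_n_plus {E : NormedModule R_AbsRing} (D : E -> Prop) (n : nat) : open D ->
  forall f h : E -> R, C_n n D f -> C_n n D h -> C_n n D (fun q => f q + h q).
Proof.
intros oD. induction n as [|n IH]; intros f h [cf df] [ch dh]; split.
1, 3: intros p Dp; apply (continuous_plus f h); auto.
- exact I.
- intros v. destruct (df v) as [ef Cf], (dh v) as [eh Ch]. split.
  + intros p Dp. apply (ex_derive_plus (K := R_AbsRing) (V := R_NormedModule)); auto.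
  + apply (C_n_ext D n oD (fun q => dir_derive v f q + dir_derive v h q)); auto.
    intros q Dq; symmetry; apply Derive_plus; auto.
Qed.

Lemma C_n_mult {E : NormedModule R_AbsRing} (D : E -> Prop) (n : nat) : open D ->
  forall f h : E -> R, C_n n D f -> C_n n D h -> C_n n D (fun q => f q * h q).
Proof.
intros oD. induction n as [|n IH]; intros f h Hf Hh;
  assert (Kf := Hf); assert (Kh := Hh); destruct Hf as [cf df], Hh as [ch dh]; split.
1, 3: intros p Dp; apply (continuous_mult (K := R_AbsRing) f h); auto.
- exact I.
- intros v. destruct (df v) as [ef Cf], (dh v) as [eh Ch]. split.
  + intros p Dp. apply ex_derive_mult; auto.
  + apply (C_n_ext D n oD (fun q => dir_derive v f q * h q + f q * dir_derive v h q)).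
    * intros q Dq; symmetry; unfold dir_derive; rewrite Derive_mult by auto.
      now rewrite line_0.
    * apply C_n_plus; auto; apply IH; auto using C_n_S.
Qed.

(** The chain rule packaged as one induction step: regularity of the outer derivative along [f] is
    left as a hypothesis at order [n]. For inverse, square root, cosine and sine that derivative is
    an expression in the same functions, so the induction hypothesis supplies it. *)
Lemma C_n_comp {E : NormedModule R_AbsRing} (D : E -> Prop) (n : nat)
    (u u' : R -> R) (f : E -> R) : open D ->
  (forall q, D q -> is_derive u (f q) (u' (f q))) ->
  C_n (S n) D f -> C_n n D (fun q => u' (f q)) -> C_n (S n) D (fun q => u (f q)).
Proof.
intros oD du [cf df] Cu. split.
- intros p Dp. apply continuous_comp; auto.
  apply (ex_derive_continuous (K := R_AbsRing) (V := R_NormedModule)).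
  eexists; apply du, Dp.
- intros v. destruct (df v) as [ef Cf].
  assert (L : forall p, D p -> ex_derive u (f (plus p (scal 0 v)))).
  { intros p Dp. rewrite line_0. eexists; apply du, Dp. }
  split.
  + intros p Dp. apply (ex_derive_comp u (fun s => f (plus p (scal s v)))); auto.
  + apply (C_n_ext D n oD (fun q => dir_derive v f q * u' (f q))).
    * intros q Dq; symmetry; unfold dir_derive.
      rewrite (Derive_comp u (fun s => f (plus q (scal s v)))) by auto.
      rewrite line_0. now rewrite (is_derive_unique u _ _ (du q Dq)).
    * now apply C_n_mult.
Qed.

Lemma C_n_inv {E : NormedModule R_AbsRing} (D : E -> Prop) (n : nat) (f : E -> R) :
  open D -> (forall q, D q -> f q <> 0) -> C_n n D f -> C_n n D (fun q => / f q).
Proof.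
intros oD nz. induction n as [|n IH]; intros Hf.
- split; [|exact I]. intros p Dp. apply continuous_comp; [now apply Hf|].
  now apply continuous_Rinv, nz.
- apply (C_n_comp D n Rinv (fun x => -1 * (/ x * / x))); auto.
  + intros q Dq. auto_derive; [now apply nz|]. field. now apply nz.
  + apply C_n_mult, C_n_mult; auto using C_n_const, C_n_S.
Qed.

Lemma C_n_sqrt {E : NormedModule R_AbsRing} (D : E -> Prop) (n : nat) (f : E -> R) :
  open D -> (forall q, D q -> 0 < f q) -> C_n n D f -> C_n n D (fun q => sqrt (f q)).
Proof.
intros oD pos. induction n as [|n IH]; intros Hf.
- split; [|exact I]. intros p Dp. apply continuous_comp; [now apply Hf|].
  apply continuous_sqrt.
- assert (nz : forall q, D q -> sqrt (f q) <> 0).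
  { intros q Dq. apply Rgt_not_eq, sqrt_lt_R0, pos, Dq. }
  apply (C_n_comp D n sqrt (fun x => / 2 * / sqrt x)); auto.
  + intros q Dq. auto_derive; [now apply pos|]. field. now apply nz.
  + apply C_n_mult; auto using C_n_const. apply C_n_inv; auto using C_n_S.
Qed.

(** A simultaneous induction, since each function supplies the derivative of the other. *)
Lemma C_n_cos_sin {E : NormedModule R_AbsRing} (D : E -> Prop) (n : nat) (f : E -> R) :
  open D -> C_n n D f -> C_n n D (fun q => cos (f q)) /\ C_n n D (fun q => sin (f q)).
Proof.
intros oD. induction n as [|n IH]; intros Hf.
- split; (split; [|exact I]); intros p Dp;
    (apply continuous_comp; [now apply Hf|]).
  apply continuous_cos. apply continuous_sin.
- destruct (IH (C_n_S _ _ _ Hf)) as [Cc Cs]. split.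
  + apply (C_n_comp D n cos (fun x => -1 * sin x)); auto.
    * intros q Dq. auto_derive; [exact I | ring].
    * apply C_n_mult; auto using C_n_const.
  + apply (C_n_comp D n sin cos); auto.
    intros q Dq. auto_derive; [exact I | ring].
Qed.

(** [l0] is the linear part of [l]. An affine map carries lines to lines, so a derivative of the
    composite along [v] is a derivative of [f] along [l0 v], again composed with [l]. Time slices
    and the projection to space are the instances. *)
Lemma C_n_comp_affine {E F : NormedModule R_AbsRing} (D : E -> Prop) (D' : F -> Prop)
    (n : nat) (l l0 : E -> F) : open D ->
  (forall p, D p -> D' (l p)) -> (forall p, continuous l p) ->
  (forall (p v : E) (s : R), l (plus p (scal s v)) = plus (l p) (scal s (l0 v))) ->
  forall f : F -> R, C_n n D' f -> C_n n D (fun p => f (l p)).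
Proof.
intros oD Dl cl al. induction n as [|n IH]; intros f [cf df]; split.
1, 3: intros p Dp; apply continuous_comp; auto.
- exact I.
- intros v. destruct (df (l0 v)) as [ef Cf]. split.
  + intros p Dp. apply ex_derive_ext with (2 := ef (l p) (Dl p Dp)).
    intros s. now rewrite al.
  + apply (C_n_ext D n oD (fun p => dir_derive (l0 v) f (l p))); [|now apply IH].
    intros q Dq. apply Derive_ext. intros s. now rewrite al.
Qed.

(** * Closure properties and mixed derivatives of smooth functions *)

Lemma smooth_on_ext {E : NormedModule R_AbsRing} (D : E -> Prop) (f h : E -> R) :
  open D -> (forall q, D q -> f q = h q) -> smooth_on D f -> smooth_on D h.
Proof. intros oD e Hf n. now apply (C_n_ext D n oD f h). Qed.

Lemma smooth_on_const {E : NormedModule R_AbsRing} (D : E -> Prop) (c : R) :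
  open D -> smooth_on D (fun _ => c).
Proof. intros oD n. now apply C_n_const. Qed.

Lemma smooth_on_plus {E : NormedModule R_AbsRing} (D : E -> Prop) (f h : E -> R) :
  open D -> smooth_on D f -> smooth_on D h -> smooth_on D (fun q => f q + h q).
Proof. intros oD Hf Hh n. now apply C_n_plus. Qed.

Lemma smooth_on_mult {E : NormedModule R_AbsRing} (D : E -> Prop) (f h : E -> R) :
  open D -> smooth_on D f -> smooth_on D h -> smooth_on D (fun q => f q * h q).
Proof. intros oD Hf Hh n. now apply C_n_mult. Qed.

Lemma smooth_on_opp {E : NormedModule R_AbsRing} (D : E -> Prop) (f : E -> R) :
  open D -> smooth_on D f -> smooth_on D (fun q => - f q).
Proof.
intros oD Hf. apply smooth_on_ext with (fun q => -1 * f q); auto.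
- intros; ring.
- apply smooth_on_mult; auto using smooth_on_const.
Qed.

Lemma smooth_on_minus {E : NormedModule R_AbsRing} (D : E -> Prop) (f h : E -> R) :
  open D -> smooth_on D f -> smooth_on D h -> smooth_on D (fun q => f q - h q).
Proof. intros. apply smooth_on_plus; auto. now apply smooth_on_opp. Qed.

Lemma smooth_on_inv {E : NormedModule R_AbsRing} (D : E -> Prop) (f : E -> R) :
  open D -> (forall q, D q -> f q <> 0) -> smooth_on D f -> smooth_on D (fun q => / f q).
Proof. intros oD nz Hf n. now apply C_n_inv. Qed.

Lemma smooth_on_div {E : NormedModule R_AbsRing} (D : E -> Prop) (f h : E -> R) :
  open D -> (forall q, D q -> h q <> 0) ->
  smooth_on D f -> smooth_on D h -> smooth_on D (fun q => f q / h q).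
Proof. intros. apply smooth_on_mult; auto. now apply smooth_on_inv. Qed.

Lemma smooth_on_sqrt {E : NormedModule R_AbsRing} (D : E -> Prop) (f : E -> R) :
  open D -> (forall q, D q -> 0 < f q) -> smooth_on D f -> smooth_on D (fun q => sqrt (f q)).
Proof. intros oD pos Hf n. now apply C_n_sqrt. Qed.

Lemma smooth_on_cos {E : NormedModule R_AbsRing} (D : E -> Prop) (f : E -> R) :
  open D -> smooth_on D f -> smooth_on D (fun q => cos (f q)).
Proof. intros oD Hf n. now apply C_n_cos_sin. Qed.

Lemma smooth_on_sin {E : NormedModule R_AbsRing} (D : E -> Prop) (f : E -> R) :
  open D -> smooth_on D f -> smooth_on D (fun q => sin (f q)).
Proof. intros oD Hf n. now apply C_n_cos_sin. Qed.

Lemma smooth_on_comp_affine {E F : NormedModule R_AbsRing} (D : E -> Prop) (D' : F -> Prop)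
    (l l0 : E -> F) (f : F -> R) : open D ->
  (forall p, D p -> D' (l p)) -> (forall p, continuous l p) ->
  (forall (p v : E) (s : R), l (plus p (scal s v)) = plus (l p) (scal s (l0 v))) ->
  smooth_on D' f -> smooth_on D (fun p => f (l p)).
Proof. intros oD Dl cl al Hf n. now apply (C_n_comp_affine D D' n l l0). Qed.

Lemma smooth_on_linear {E : NormedModule R_AbsRing} (D : E -> Prop) (l : E -> R) :
  open D -> (forall p, continuous l p) ->
  (forall (p v : E) (s : R), l (plus p (scal s v)) = l p + s * l v) -> smooth_on D l.
Proof.
intros oD cl al [|n]; split; auto. intros v.
assert (H : forall p s, is_derive (fun s : R => l (plus p (scal s v))) s (l v)).
{ intros p s. apply is_derive_ext with (fun s => l p + s * l v); [intros; now rewrite al|].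
  auto_derive; [exact I | ring]. }
split; [intros p _; eexists; apply H|].
apply (C_n_ext D n oD (fun _ => l v)); [|now apply C_n_const].
intros q _. symmetry. apply is_derive_unique, H.
Qed.

Lemma smooth_on_dir {E : NormedModule R_AbsRing} (D : E -> Prop) (v : E) (f : E -> R) :
  smooth_on D f -> smooth_on D (dir_derive v f).
Proof. intros Hf n. apply (Hf (S n)). Qed.

Lemma smooth_on_continuous {E : NormedModule R_AbsRing} (D : E -> Prop) (f : E -> R) (p : E) :
  smooth_on D f -> D p -> continuous f p.
Proof. intros Hf. apply (C_n_0 D 0 f (Hf 0%nat)). Qed.

Lemma smooth_on_ex_derive {E : NormedModule R_AbsRing} (D : E -> Prop) (f : E -> R) (p v : E) :
  smooth_on D f -> D p -> ex_derive (fun s : R => f (plus p (scal s v))) 0.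
Proof. intros Hf. now apply (Hf 1%nat). Qed.

(** [C_n] differentiates at parameter 0 only; moving the base point along the line gives the
    derivative at every parameter. *)
Lemma smooth_on_line {E : NormedModule R_AbsRing} (D : E -> Prop) (f : E -> R)
    (p v : E) (s : R) : smooth_on D f -> D (plus p (scal s v)) ->
  is_derive (fun r : R => f (plus p (scal r v))) s (dir_derive v f (plus p (scal s v))).
Proof.
intros Hf Ds.
assert (H := Derive_correct _ _ (smooth_on_ex_derive D f _ v Hf Ds)).
apply is_derive_ext with (fun r => f (plus (plus p (scal s v)) (scal (r - s) v))).
{ intros r. f_equal. rewrite <- plus_assoc. f_equal.
  apply (eq_trans (eq_sym (scal_distr_r (K := R_AbsRing) s (r - s) v))).
  replace r with (plus s (r - s)) at 2; [reflexivity|].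
  change (s + (r - s) = r). ring. }
replace (dir_derive v f (plus p (scal s v)))
  with (scal (K := R_AbsRing) (V := R_NormedModule) 1 (dir_derive v f (plus p (scal s v))))
  by apply Rmult_1_l.
apply (is_derive_comp (fun r => f (plus (plus p (scal s v)) (scal r v)))).
- replace (s - s) with 0 by ring. exact H.
- auto_derive; [exact I | ring].
Qed.

Lemma dir_derive_swap {E : NormedModule R_AbsRing} (D : E -> Prop) (f : E -> R) (u v p : E) :
  open D -> smooth_on D f -> D p ->
  dir_derive u (dir_derive v f) p = dir_derive v (dir_derive u f) p.
Proof.
intros oD Hf Dp.
(* The parametrised plane p + x u + y v reduces the claim to Schwarz's theorem in two real
   variables. The two orders of summation [l] and [l'] let either variable be the one that moves
   along a line. *)
set (l := fun z : R * R => plus (plus p (scal (fst z) u)) (scal (snd z) v)).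
set (l' := fun z : R * R => plus (plus p (scal (snd z) v)) (scal (fst z) u)).
assert (ll : forall z, l z = l' z).
{ intros z. unfold l, l'. now rewrite <- !plus_assoc, (plus_comm (scal (fst z) u)). }
assert (cl : forall z, continuous l z).
{ intros z. apply (continuous_plus (fun z : R * R => plus p (scal (fst z) u))
      (fun z : R * R => scal (snd z) v)).
  - apply (continuous_comp fst (fun s : R => plus p (scal s u)));
      [destruct z; apply continuous_fst | apply line_continuous].
  - apply (continuous_scal (fun z : R * R => snd z) (fun _ => v));
      [destruct z; apply continuous_snd | apply continuous_const]. }
assert (l00 : l (0, 0) = p) by (unfold l; simpl; now rewrite !line_0).
set (F := fun x y : R => f (l (x, y))).
assert (d1 : forall h, smooth_on D h -> forall x y, D (l (x, y)) ->
  is_derive (fun x => h (l (x, y))) x (dir_derive u h (l (x, y)))).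
{ intros h Hh x y Dl. apply is_derive_ext with (fun x => h (l' (x, y))).
  { intros; now rewrite ll. }
  rewrite ll in *. now apply (smooth_on_line D h (plus p (scal y v)) u x). }
assert (d2 : forall h, smooth_on D h -> forall x y, D (l (x, y)) ->
  is_derive (fun y => h (l (x, y))) y (dir_derive v h (l (x, y)))).
{ intros h Hh x y Dl. now apply (smooth_on_line D h (plus p (scal x u)) v y). }
assert (L : locally (0, 0) (fun z => D (l z))).
{ apply (cl (0, 0) D). apply oD. now rewrite l00. }
assert (LL : locally (0, 0) (fun z => locally z (fun z' => D (l z')))).
{ now apply locally_locally. }
assert (Lx : forall x y : R, locally ((x, y) : R * R) (fun z => D (l z)) -> locally x (fun x' => D (l (x', y)))).
{ intros x y [d H]. exists d. intros x' b. apply H. split; [exact b | apply ball_center]. }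
assert (Ly : forall x y : R, locally ((x, y) : R * R) (fun z => D (l z)) -> locally y (fun y' => D (l (x, y')))).
{ intros x y [d H]. exists d. intros x' b. apply H. split; [apply ball_center | exact b]. }
assert (D12 : forall x y : R, locally ((x, y) : R * R) (fun z => D (l z)) ->
  is_derive (fun z => Derive (fun t => F z t) y) x (dir_derive u (dir_derive v f) (l (x, y)))).
{ intros x y H. apply is_derive_ext_loc with (fun z => dir_derive v f (l (z, y))).
  - apply filter_imp with (2 := Lx x y H). intros z Dz. symmetry. apply is_derive_unique.
    now apply d2.
  - apply d1; [now apply smooth_on_dir | now apply locally_singleton in H]. }
assert (D21 : forall x y : R, locally ((x, y) : R * R) (fun z => D (l z)) ->
  is_derive (fun z => Derive (fun t => F t z) x) y (dir_derive v (dir_derive u f) (l (x, y)))).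
{ intros x y H. apply is_derive_ext_loc with (fun z => dir_derive u f (l (x, z))).
  - apply filter_imp with (2 := Ly x y H). intros z Dz. symmetry. apply is_derive_unique.
    now apply d1.
  - apply d2; [now apply smooth_on_dir | now apply locally_singleton in H]. }
assert (E12 := is_derive_unique _ _ _ (D12 0 0 L)).
assert (E21 := is_derive_unique _ _ _ (D21 0 0 L)).
rewrite l00 in E12, E21. rewrite <- E12, <- E21. clear E12 E21.
assert (C : forall h, smooth_on D h -> continuous (fun z => h (l z)) (0, 0)).
{ intros h Hh. apply continuous_comp; [apply cl|]. apply (smooth_on_continuous D); auto.
  now rewrite l00. }
apply Schwarz.
- apply locally_2d_locally. apply filter_imp with (2 := LL). intros [x y] H.
  assert (Dl : D (l (x, y))) by now apply locally_singleton in H.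
  simpl. repeat split; eexists.
  now apply d1. now apply d2. now apply D12. now apply D21.
- apply continuity_2d_pt_ext_loc with (fun x y => dir_derive u (dir_derive v f) (l (x, y))).
  + apply locally_2d_locally. apply filter_imp with (2 := LL). intros [x y] H.
    symmetry. now apply is_derive_unique, D12.
  + apply continuity_2d_pt_filterlim.
    apply filterlim_ext with (fun z => dir_derive u (dir_derive v f) (l z)).
    { now intros []. }
    apply C. now do 2 apply smooth_on_dir.
- apply continuity_2d_pt_ext_loc with (fun x y => dir_derive v (dir_derive u f) (l (x, y))).
  + apply locally_2d_locally. apply filter_imp with (2 := LL). intros [x y] H.
    symmetry. now apply is_derive_unique, D21.
  + apply continuity_2d_pt_filterlim.
    apply filterlim_ext with (fun z => dir_derive v (dir_derive u f) (l z)).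
    { now intros []. }
    apply C. now do 2 apply smooth_on_dir.
Qed.

(** * The plane and space-time *)

Notation plane_module := (prod_NormedModule R_AbsRing R_NormedModule R_NormedModule).

Notation spacetime := (prod_NormedModule R_AbsRing R_NormedModule plane_module).

Definition slab (eps : R) (q : spacetime) : Prop := Rabs (fst q) < eps.

Definition basis (k : ix) : plane := match k with I1 => (1, 0) | I2 => (0, 1) end.

Definition dt (F : R * plane -> R) : R * plane -> R :=
  dir_derive (E := spacetime) (1, (0, 0)) F.

Definition dx (k : ix) (F : R * plane -> R) : R * plane -> R :=
  dir_derive (E := spacetime) (0, basis k) F.

Lemma slab_open (eps : R) : open (slab eps).
Proof.
apply (open_comp (fun q : spacetime => Rabs (fst q)) (fun u => u < eps)); [|apply open_lt].
intros [t p] _. apply (continuous_comp fst Rabs (t, p)); [apply continuous_fst|].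
apply continuous_Rabs.
Qed.

Lemma locally_slab (eps t : R) : Rabs t < eps -> locally t (fun s => Rabs s < eps).
Proof.
intros H. apply (open_comp Rabs (fun u => u < eps)); [|apply open_lt | exact H].
intros x _. apply continuous_Rabs.
Qed.

Lemma Derive_shift (f : R -> R) (x : R) : Derive (fun s => f (x + s)) 0 = Derive f x.
Proof.
unfold Derive. f_equal. apply Lim_ext. intros h. now rewrite Rplus_0_l, Rplus_0_r.
Qed.

Lemma plane_line (x y s u v : R) :
  plus (x, y) (scal s (u, v)) = (x + s * u, y + s * v).
Proof. reflexivity. Qed.

Lemma spacetime_line (t x y s u v w : R) :
  plus (G := spacetime) (t, (x, y)) (scal (V := spacetime) s (u, (v, w))) =
  (t + s * u, (x + s * v, y + s * w)).
Proof. reflexivity. Qed.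

Lemma partial_dir (k : ix) (f : plane -> R) (p : plane) :
  partial k f p = dir_derive (E := plane_module)
    (basis k) f p.
Proof.
destruct p as [x y], k; unfold partial, dir_derive; rewrite <- Derive_shift;
  apply Derive_ext; intros s; unfold basis; rewrite plane_line; simpl;
  now rewrite Rmult_1_r, Rmult_0_r, Rplus_0_r.
Qed.

Lemma partial_dx (k : ix) (F : R * plane -> R) (t : R) (p : plane) :
  partial k (fun p => F (t, p)) p = dx k F (t, p).
Proof.
destruct p as [x y], k; unfold partial, dx, dir_derive; rewrite <- Derive_shift;
  apply Derive_ext; intros s; unfold basis; rewrite spacetime_line; simpl;
  now rewrite Rmult_1_r, Rmult_0_r, !Rplus_0_r.
Qed.

Lemma time_line (t s : R) (p : plane) :
  plus (G := spacetime) (t, p) (scal (V := spacetime) s (1, (0, 0))) = (t + s, p).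
Proof.
destruct p as [x y]. rewrite spacetime_line. now rewrite Rmult_1_r, !Rmult_0_r, !Rplus_0_r.
Qed.

Lemma Derive_dt (F : R * plane -> R) (t : R) (p : plane) :
  Derive (fun t => F (t, p)) t = dt F (t, p).
Proof.
unfold dt, dir_derive. rewrite <- Derive_shift. apply Derive_ext. intros s.
now rewrite time_line.
Qed.

Lemma is_derive_dt (eps : R) (F : R * plane -> R) (t : R) (p : plane) :
  smooth_on (slab eps) F -> Rabs t < eps -> is_derive (fun t => F (t, p)) t (dt F (t, p)).
Proof.
intros HF Ht. rewrite <- Derive_dt. apply Derive_correct.
assert (L : forall s : R, plus (G := spacetime) (0, p) (scal (V := spacetime) s (1, (0, 0))) = (s, p)).
{ intros s. rewrite time_line. now rewrite Rplus_0_l. }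
assert (H := smooth_on_line (E := spacetime) (slab eps) F (0, p) (1, (0, 0)) t HF).
rewrite L in H. specialize (H Ht). eexists. apply is_derive_ext with (2 := H).
intros s. now rewrite L.
Qed.

Lemma dt_ext (eps : R) (F G : R * plane -> R) (q : R * plane) : Rabs (fst q) < eps ->
  (forall q, Rabs (fst q) < eps -> F q = G q) -> dt F q = dt G q.
Proof. intros Hq e. apply dir_derive_ext with (slab eps); auto using slab_open. Qed.

Lemma dt_plus (eps : R) (F G : R * plane -> R) (q : R * plane) :
  smooth_on (slab eps) F -> smooth_on (slab eps) G -> Rabs (fst q) < eps ->
  dt (fun q => F q + G q) q = dt F q + dt G q.
Proof. intros HF HG Hq. apply Derive_plus; now apply (smooth_on_ex_derive (slab eps)). Qed.

Lemma dt_mult (eps : R) (F G : R * plane -> R) (q : R * plane) :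
  smooth_on (slab eps) F -> smooth_on (slab eps) G -> Rabs (fst q) < eps ->
  dt (fun q => F q * G q) q = dt F q * G q + F q * dt G q.
Proof.
intros HF HG Hq. unfold dt, dir_derive. rewrite Derive_mult.
- now rewrite line_0.
- now apply (smooth_on_ex_derive (slab eps) F).
- now apply (smooth_on_ex_derive (slab eps) G).
Qed.

Lemma dt_opp (F : R * plane -> R) (q : R * plane) : dt (fun q => - F q) q = - dt F q.
Proof. apply Derive_opp. Qed.

Lemma dt_space (f : plane -> R) (q : R * plane) : dt (fun q => f (snd q)) q = 0.
Proof.
destruct q as [t p]. unfold dt, dir_derive. rewrite (Derive_ext _ (fun _ => f p)); [apply Derive_const|].
intros s. now rewrite time_line.
Qed.

Lemma smooth_partial (k : ix) (f : plane -> R) : smooth f -> smooth (partial k f).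
Proof.
intros Hf. apply smooth_on_ext with (2 := fun q _ => eq_sym (partial_dir k f q)).
- apply open_true.
- now apply smooth_on_dir.
Qed.

Lemma partial_plus (k : ix) (f h : plane -> R) (p : plane) : smooth f -> smooth h ->
  partial k (fun p => f p + h p) p = partial k f p + partial k h p.
Proof.
intros Hf Hh. rewrite !partial_dir.
apply Derive_plus; now apply (smooth_on_ex_derive (fun _ => True)).
Qed.

Lemma partial_mult (k : ix) (f h : plane -> R) (p : plane) : smooth f -> smooth h ->
  partial k (fun p => f p * h p) p = partial k f p * h p + f p * partial k h p.
Proof.
intros Hf Hh. rewrite !partial_dir. unfold dir_derive. rewrite Derive_mult.
- now rewrite line_0.
- now apply (smooth_on_ex_derive (fun _ => True) f).
- now apply (smooth_on_ex_derive (fun _ => True) h).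
Qed.

Lemma partial_opp (k : ix) (f : plane -> R) (p : plane) :
  partial k (fun p => - f p) p = - partial k f p.
Proof. rewrite !partial_dir. apply Derive_opp. Qed.

Lemma partial_const (k : ix) (c : R) (p : plane) : partial k (fun _ => c) p = 0.
Proof. rewrite partial_dir. apply (Derive_const c). Qed.

Lemma smooth_dt (eps : R) (F : R * plane -> R) :
  smooth_on (slab eps) F -> smooth_on (slab eps) (dt F).
Proof. apply smooth_on_dir. Qed.

Lemma smooth_slice_partial (eps : R) (k : ix) (F : R * plane -> R) :
  smooth_on (slab eps) F ->
  smooth_on (slab eps) (fun q : R * plane => partial k (fun p => F (fst q, p)) (snd q)).
Proof.
intros HF. apply smooth_on_ext with (dx k F); [apply slab_open| |now apply smooth_on_dir].
intros [t p] _. symmetry. apply (partial_dx k F t p).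
Qed.

Lemma smooth_space (eps : R) (f : plane -> R) :
  smooth f -> smooth_on (slab eps) (fun q : R * plane => f (snd q)).
Proof.
apply smooth_on_comp_affine with (l := fun q : spacetime => snd q) (l0 := snd); auto.
- apply slab_open.
- intros []. apply continuous_snd.
Qed.

Lemma smooth_slice (eps t : R) (F : R * plane -> R) :
  Rabs t < eps -> smooth_on (slab eps) F -> smooth (fun p => F (t, p)).
Proof.
intros Ht. apply (smooth_on_comp_affine
  (E := plane_module) (F := spacetime)
  (fun _ => True) (slab eps) (fun p => (t, p)) (fun p => (0, p))).
- apply open_true.
- intros; exact Ht.
- intros p. apply (continuous_pair (fun _ => t) (fun p => p));
    [apply continuous_const | apply continuous_id].
- intros p v s. unfold plus at 2, scal at 2; simpl; unfold prod_plus, prod_scal; simpl. f_equal.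
  unfold plus, scal; simpl; unfold mult; simpl. ring.
Qed.

(** Symmetry of mixed derivatives in space-time; it is what lets the time derivative pass through
    [covariant] and [codiff]. *)
Lemma dt_partial (eps : R) (k : ix) (F : R * plane -> R) (t : R) (p : plane) :
  smooth_on (slab eps) F -> Rabs t < eps ->
  dt (fun q => partial k (fun p => F (fst q, p)) (snd q)) (t, p) =
  partial k (fun p => dt F (t, p)) p.
Proof.
intros HF Ht. rewrite (partial_dx k (dt F)).
transitivity (dt (dx k F) (t, p)).
- apply dt_ext with eps; [exact Ht|]. intros [s r] _. apply partial_dx.
- apply dir_derive_swap with (slab eps); auto using slab_open.
Qed.

(** * Differentiation under the integral sign *)

Lemma continuous_slice {U : UniformSpace} (h : U -> R -> R) (u : U) (r : R) :
  continuous (fun z : U * R => h (fst z) (snd z)) (u, r) -> continuous (h u) r.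
Proof.
intros c. apply (continuous_comp (fun r => (u, r)) (fun z : U * R => h (fst z) (snd z)));
  [|exact c].
apply (continuous_pair (fun _ => u) (fun r => r)); [apply continuous_const | apply continuous_id].
Qed.

Lemma ex_RInt_slice {U : UniformSpace} (h : U -> R -> R) (u : U) (a b : R) :
  (forall r, continuous (fun z : U * R => h (fst z) (snd z)) (u, r)) -> ex_RInt (h u) a b.
Proof.
intros c. apply (ex_RInt_continuous (V := R_CompleteNormedModule)).
intros r _. now apply continuous_slice.
Qed.

(** Compactness of [0, 1] turns the neighbourhoods of [u] chosen at each [r] into a single one that
    serves all [r]. The parameter space is a general uniform space so that the inner of two
    integrals can be treated with the pair (t, s) as parameter. *)
Lemma continuous_RInt_param {U : UniformSpace} (D : U -> Prop) (h : U -> R -> R) (u : U) :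
  open D -> D u ->
  (forall u r, D u -> continuous (fun z : U * R => h (fst z) (snd z)) (u, r)) ->
  continuous (fun u => RInt (h u) 0 1) u.
Proof.
intros oD Du c. apply filterlim_locally. intros e.
(* Two comparisons through a nearby centre cost [e / 4] each, so the integrands differ by at most
   [e / 2]; integration over length 1 then leaves room for the strict inequality. *)
assert (e2 : 0 < e / 4) by (destruct e; simpl; lra).
assert (B : forall r, exists d : posreal, forall u' r', ball u d u' -> Rabs (r' - r) < d ->
  Rabs (h u' r' - h u r) < e / 4).
{ intros r.
  destruct (proj1 (filterlim_locally _ _) (c u r Du) (mkposreal _ e2)) as [d H].
  exists d. intros u' r' bu br. apply (H (u', r')). split; [exact bu|].
  exact br. }
(* The compactness lemma takes its gauge as a function of [r], hence the choice. *)
assert (DD : exists delta : R -> posreal, forall r u' r', ball u (delta r) u' ->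
  Rabs (r' - r) < delta r -> Rabs (h u' r' - h u r) < e / 4).
{ exists (fun r => proj1_sig (ClassicalEpsilon.constructive_indefinite_description _ (B r))).
  intros r. apply (proj2_sig (ClassicalEpsilon.constructive_indefinite_description _ (B r))). }
destruct DD as [delta Hd].
destruct (compactness_value_1d 0 1 delta) as [d Hc].
destruct (oD u Du) as [dD HD].
exists (mkposreal _ (Rmin_stable_in_posreal d dD)). intros u' bu. simpl in bu.
assert (b1 : ball u d u') by (apply ball_le with (2 := bu); apply Rmin_l).
assert (Du' : D u') by (apply HD, ball_le with (2 := bu); apply Rmin_r).
change (Rabs (RInt (h u') 0 1 - RInt (h u) 0 1) < e).
assert (x1 := ex_RInt_slice h u' 0 1 (fun r => c u' r Du')).
assert (x2 := ex_RInt_slice h u 0 1 (fun r => c u r Du)).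
assert (E := RInt_minus (V := R_CompleteNormedModule) _ _ 0 1 x1 x2).
change (RInt (fun r => h u' r - h u r) 0 1 = RInt (h u') 0 1 - RInt (h u) 0 1) in E.
rewrite <- E.
apply Rle_lt_trans with ((1 - 0) * (e / 2)); [|destruct e; simpl; lra].
apply abs_RInt_le_const; [lra| |].
- apply (ex_RInt_minus (V := R_NormedModule)); assumption.
(* The covering property comes doubly negated, so the pointwise bound is reached by
   contradiction. *)
- intros r Hr. apply Rnot_lt_le. intros Hlt. apply (Hc r Hr).
  intros [s (Hs & Hrs & Hds)].
  assert (q1 := Hd s u' r (ball_le _ _ _ Hds _ b1) Hrs).
  assert (q2 := Hd s u r (ball_center _ _) Hrs).
  revert Hlt q1 q2. unfold Rabs. repeat destruct Rcase_abs; lra.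
Qed.

Lemma is_derive_RInt_slab (eps : R) (h h' : R -> R -> R) (t : R) : Rabs t < eps ->
  (forall t r, Rabs t < eps -> is_derive (fun t => h t r) t (h' t r)) ->
  (forall t r, Rabs t < eps -> continuous (h t) r) ->
  (forall t r, Rabs t < eps -> continuous (fun z : R * R => h' (fst z) (snd z)) (t, r)) ->
  is_derive (fun t => RInt (h t) 0 1) t (RInt (h' t) 0 1).
Proof.
intros Ht d c c'.
replace (RInt (h' t) 0 1) with (RInt (fun r => Derive (fun u => h u r) t) 0 1)
  by (apply RInt_ext; intros; now apply is_derive_unique, d).
assert (L := locally_slab eps t Ht).
apply is_derive_RInt_param.
- apply filter_imp with (2 := L). intros s Hs r _. eexists. now apply d.
- intros r _. apply continuity_2d_pt_ext_loc with h'.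
  + destruct L as [del L]. exists del. intros u v Hu _. symmetry.
    apply is_derive_unique, d, L, Hu.
  + apply continuity_2d_pt_filterlim, c', Ht.
- apply filter_imp with (2 := L). intros s Hs.
  apply (ex_RInt_continuous (V := R_CompleteNormedModule)). intros; now apply c.
Qed.

(** The weight [sqrt (det g) * |cross a b|] of [torus_integral] is absorbed into the integrand by
    [energy_form], so that differentiation and positivity concern an unweighted double integral. *)
Definition fundamental_integral (a b : plane) (f : plane -> R) : R :=
  RInt (fun s => RInt (fun r => f (comb a b s r)) 0 1) 0 1.

Lemma continuous_comb (a b : plane) (s r : R) :
  continuous (fun z : R * R => comb a b (fst z) (snd z)) (s, r).
Proof.
apply continuous_pair;
  apply (continuous_plus (V := R_NormedModule) (fun z : R * R => fst z * _) (fun z : R * R => snd z * _));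
  apply (continuous_mult (K := R_AbsRing)); try apply continuous_const;
  first [apply continuous_fst | apply continuous_snd].
Qed.

Lemma is_derive_fundamental_integral (a b : plane) (eps t : R) (F : R * plane -> R) :
  smooth_on (slab eps) F -> Rabs t < eps ->
  is_derive (fun t => fundamental_integral a b (fun p => F (t, p))) t
    (fundamental_integral a b (fun p => dt F (t, p))).
Proof.
intros HF Ht.
(* Joint continuity in (t, s, r), from which [C2] integrates out [r]. *)
assert (C : forall G : R * plane -> R, smooth_on (slab eps) G -> forall t s r, Rabs t < eps ->
  continuous (fun z : (R * R) * R => G (fst (fst z), comb a b (snd (fst z)) (snd z))) ((t, s), r)).
{ clear t Ht. intros G HG t s r Ht.
  apply (continuous_comp (fun z : (R * R) * R => (fst (fst z), comb a b (snd (fst z)) (snd z))) G).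
  2: now apply (smooth_on_continuous (E := spacetime) (slab eps)).
  apply continuous_pair.
  - apply (continuous_comp fst fst); apply continuous_fst.
  - apply (continuous_comp (fun z : (R * R) * R => (snd (fst z), snd z))
      (fun z : R * R => comb a b (fst z) (snd z))); [|apply continuous_comb].
    apply continuous_pair; [|apply continuous_snd].
    apply (continuous_comp fst snd); [apply continuous_fst | apply continuous_snd]. }
assert (C2 : forall G : R * plane -> R, smooth_on (slab eps) G -> forall t s, Rabs t < eps ->
  continuous (fun z : R * R => RInt (fun r => G (fst z, comb a b (snd z) r)) 0 1) (t, s)).
{ intros G HG t' s' Ht'.
  apply (continuous_RInt_param (fun z : R * R => Rabs (fst z) < eps)
    (fun z r => G (fst z, comb a b (snd z) r))); [|exact Ht'|].
  - apply (open_comp fst (fun u => Rabs u < eps)).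
    + intros [] _. apply continuous_fst.
    + intros u Hu. now apply locally_slab.
  - intros [t1 s1] r H1. now apply C. }
unfold fundamental_integral.
(* The same lemma is applied twice: to the outer integral here, and to the inner one to
   differentiate its integrand. *)
apply (is_derive_RInt_slab eps (fun t s => RInt (fun r => F (t, comb a b s r)) 0 1)
  (fun t s => RInt (fun r => dt F (t, comb a b s r)) 0 1)); [exact Ht| | |].
- intros t' s Ht'.
  apply (is_derive_RInt_slab eps (fun t r => F (t, comb a b s r))
    (fun t r => dt F (t, comb a b s r))); [exact Ht'| | |].
  + intros t1 r Ht1. now apply is_derive_dt with eps.
  + intros t1 r Ht1.
    apply (continuous_slice (fun (z : R * R) r => F (fst z, comb a b (snd z) r)) (t1, s)).
    now apply C.
  + intros t1 r Ht1.
    apply (continuous_comp (fun z : R * R => ((fst z, s), snd z))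
      (fun z : (R * R) * R => dt F (fst (fst z), comb a b (snd (fst z)) (snd z)))).
    2: apply C; [now apply smooth_dt | exact Ht1].
    apply continuous_pair; [|apply continuous_snd].
    apply continuous_pair; [apply continuous_fst | apply continuous_const].
- intros t1 s Ht1. apply (continuous_slice (fun t s => RInt (fun r => F (t, comb a b s r)) 0 1)).
  now apply C2.
- intros t1 s Ht1. apply C2; [now apply smooth_dt | exact Ht1].
Qed.

Lemma fundamental_integral_ext (a b : plane) (f h : plane -> R) :
  (forall p, f p = h p) -> fundamental_integral a b f = fundamental_integral a b h.
Proof. intros e. apply RInt_ext; intros; apply RInt_ext; intros; apply e. Qed.

Lemma continuous_on_fundamental (a b : plane) (f : plane -> R) : smooth f -> forall s r,
  continuous (fun z : R * R => f (comb a b (fst z) (snd z))) (s, r).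
Proof.
intros Hf s r. apply (continuous_comp (fun z : R * R => comb a b (fst z) (snd z)) f).
- apply continuous_comb.
- now apply (smooth_on_continuous (E := plane_module) (fun _ => True)).
Qed.

Lemma continuous_fundamental_slice (a b : plane) (f : plane -> R) (s : R) : smooth f ->
  continuous (fun s => RInt (fun r => f (comb a b s r)) 0 1) s.
Proof.
intros Hf. apply (continuous_RInt_param (fun _ => True) (fun s r => f (comb a b s r)));
  [apply open_true | exact I |]. intros. now apply continuous_on_fundamental.
Qed.

Lemma fundamental_integral_plus (a b : plane) (f h : plane -> R) : smooth f -> smooth h ->
  fundamental_integral a b (fun p => f p + h p) =
  fundamental_integral a b f + fundamental_integral a b h.
Proof.
intros Hf Hh. unfold fundamental_integral.
assert (X : forall f, smooth f ->
  ex_RInt (fun s => RInt (fun r => f (comb a b s r)) 0 1) 0 1).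
{ intros k Hk. apply (ex_RInt_continuous (V := R_CompleteNormedModule)).
  intros. now apply continuous_fundamental_slice. }
rewrite <- (RInt_plus (V := R_CompleteNormedModule)
  (fun s => RInt (fun r => f (comb a b s r)) 0 1)
  (fun s => RInt (fun r => h (comb a b s r)) 0 1)) by auto.
apply RInt_ext. intros s _.
apply (RInt_plus (V := R_CompleteNormedModule) (fun r => f (comb a b s r))
  (fun r => h (comb a b s r)));
  apply (ex_RInt_slice (fun s r => _ (comb a b s r))); intros;
  now apply continuous_on_fundamental.
Qed.

Lemma fundamental_integral_ge0 (a b : plane) (f : plane -> R) : smooth f ->
  (forall p, 0 <= f p) -> 0 <= fundamental_integral a b f.
Proof.
intros Hf pos. apply RInt_ge_0; [lra| |].
- apply (ex_RInt_continuous (V := R_CompleteNormedModule)).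
  intros. now apply continuous_fundamental_slice.
- intros s _. apply RInt_ge_0; [lra| |auto].
  apply (ex_RInt_slice (fun s r => f (comb a b s r))). intros.
  now apply continuous_on_fundamental.
Qed.

(** * The connection form and the bienergy density *)

Ltac smoothness :=
  repeat first
    [ assumption | apply open_true | apply slab_open
    | match goal with H : smooth_field _ |- _ => exact (H _) end
    | match goal with H : forall i : ix, _ |- _ => apply H end
    | refine (smooth_on_const _ _ _) | refine (smooth_on_plus _ _ _ _ _ _)
    | refine (smooth_on_minus _ _ _ _ _ _) | refine (smooth_on_opp _ _ _ _)
    | refine (smooth_on_mult _ _ _ _ _ _) | apply smooth_partial ].

Lemma smooth_metric (a b : plane) (g : metric) (i j : ix) : riemannian a b g -> smooth (g i j).
Proof. intros [H _]. apply H. Qed.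

Lemma smooth_det (a b : plane) (g : metric) : riemannian a b g -> smooth (det g).
Proof.
intros hg. assert (H := fun i j => smooth_metric a b g i j hg). unfold det. smoothness.
Qed.

Lemma smooth_vol (a b : plane) (g : metric) :
  riemannian a b g -> smooth (fun p => sqrt (det g p)).
Proof.
intros hg. apply smooth_on_sqrt.
- apply open_true.
- intros p _. apply (det_pos a b g p hg).
- now apply (smooth_det a b).
Qed.

Lemma smooth_christoffel (a b : plane) (g : metric) (k i j : ix) :
  riemannian a b g -> smooth (christoffel g k i j).
Proof.
intros hg. assert (H := fun i j => smooth_metric a b g i j hg).
assert (nz : forall p : plane, True -> det g p <> 0).
{ intros p _. apply Rgt_not_eq, (det_pos a b g p hg). }
assert (Hd := smooth_det a b g hg).
assert (Hi : forall i j, smooth (ginv g i j)).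
{ intros [] []; apply (smooth_on_div (E := plane_module)); smoothness. }
unfold christoffel, sum2. smoothness.
Qed.

Lemma smooth_frame (a b : plane) (g : metric) (i : ix) :
  riemannian a b g -> smooth_field (frame g i).
Proof.
intros hg. assert (H := fun i j => smooth_metric a b g i j hg).
assert (Hd := smooth_det a b g hg).
assert (H1 : forall p : plane, True -> 0 < g I1 I1 p) by (intros p _; apply (det_pos a b g p hg)).
assert (H2 : forall p : plane, True -> 0 < g I1 I1 p * det g p).
{ intros p _. apply Rmult_lt_0_compat; apply (det_pos a b g p hg). }
assert (S1 : smooth (fun p => sqrt (g I1 I1 p))) by (apply smooth_on_sqrt; smoothness).
assert (S2 : smooth (fun p => sqrt (g I1 I1 p * det g p))) by (apply smooth_on_sqrt; smoothness).
assert (N1 : forall p : plane, True -> sqrt (g I1 I1 p) <> 0).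
{ intros p hp. now apply Rgt_not_eq, sqrt_lt_R0, H1. }
assert (N2 : forall p : plane, True -> sqrt (g I1 I1 p * det g p) <> 0).
{ intros p hp. now apply Rgt_not_eq, sqrt_lt_R0, H2. }
destruct i; intros []; simpl.
- apply (smooth_on_inv (E := plane_module)); smoothness.
- apply smooth_on_const, open_true.
- apply (smooth_on_div (E := plane_module)); smoothness.
- apply (smooth_on_div (E := plane_module)); smoothness.
Qed.

(** The derivative of [V] along a coordinate field. [nabla g X] is the combination of these with the
    components of [X], which isolates the derivatives of [X] when connections are iterated. *)
Definition covariant (g : metric) (V : field) (i : ix) : field := fun p =>
  vec (fun k => partial i (fun q => coord k (V q)) p +
    sum2 (fun j => christoffel g k i j p * coord j (V p))).

Lemma coord_vec (k : ix) (f : ix -> R) : coord k (vec f) = f k.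
Proof. now destruct k. Qed.

Lemma coord_nabla (g : metric) (X Y : field) (k : ix) (p : plane) :
  coord k (nabla g X Y p) = sum2 (fun i => coord i (X p) * coord k (covariant g Y i p)).
Proof. now destruct k. Qed.

Lemma smooth_covariant (a b : plane) (g : metric) (V : field) (i : ix) :
  riemannian a b g -> smooth_field V -> smooth_field (covariant g V i).
Proof.
intros hg hV k. assert (H := fun k i j => smooth_christoffel a b g k i j hg).
apply (smooth_on_ext (E := plane_module) _ (fun p => partial i (fun q => coord k (V q)) p +
    sum2 (fun j => christoffel g k i j p * coord j (V p)))); [apply open_true | |].
- intros. symmetry. apply coord_vec.
- unfold sum2. smoothness.
Qed.

Lemma smooth_nabla (a b : plane) (g : metric) (X Y : field) :
  riemannian a b g -> smooth_field X -> smooth_field Y -> smooth_field (nabla g X Y).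
Proof.
intros hg hX hY k. assert (H := fun i => smooth_covariant a b g Y i hg hY).
apply (smooth_on_ext (E := plane_module) _
  (fun p => sum2 (fun i => coord i (X p) * coord k (covariant g Y i p)))); [apply open_true | |].
- intros. symmetry. apply coord_nabla.
- unfold sum2. smoothness; apply H.
Qed.

(* The Riemannian area form, i.e. g(J u, v). *)
Definition area (g : metric) (p u v : plane) : R :=
  sqrt (det g p) * (coord I1 u * coord I2 v - coord I2 u * coord I1 v).

Lemma partial_minus (k : ix) (f h : plane -> R) (p : plane) : smooth f -> smooth h ->
  partial k (fun p => f p - h p) p = partial k f p - partial k h p.
Proof.
intros Hf Hh. unfold Rminus. rewrite partial_plus, partial_opp; auto. smoothness.
Qed.

(** Jacobi's formula for the derivative of a determinant, combined with compatibility of connection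
    and metric. *)
Lemma partial_vol (a b : plane) (g : metric) (i : ix) (p : plane) : riemannian a b g ->
  partial i (fun q => sqrt (det g q)) p =
  sqrt (det g p) * (christoffel g I1 i I1 p + christoffel g I2 i I2 p).
Proof.
intros hg. assert (H := fun i j => smooth_metric a b g i j hg).
assert (Hv := smooth_vol a b g hg).
assert (pos : 0 < sqrt (det g p)) by (apply sqrt_lt_R0, (det_pos a b g p hg)).
assert (sq : forall q, det g q = sqrt (det g q) * sqrt (det g q)).
{ intros q. symmetry. apply sqrt_sqrt, Rlt_le, (det_pos a b g q hg). }
(* Differentiating the square of the density avoids differentiating a square root: the product rule
   yields the unknown derivative times twice the density, and [christoffel_metric] evaluates the
   derivative of [det g]. *)
assert (E := partial_ext i _ _ p sq).
rewrite (partial_mult i _ _ p Hv Hv) in E. unfold det at 1 in E.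
rewrite partial_minus, !partial_mult in E by smoothness.
rewrite !(christoffel_metric a b g _ _ _ p hg) in E. unfold sum2 in E.
assert (sym := proj1 (proj2 (proj2 hg)) I2 I1 p).
apply Rmult_eq_reg_l with (2 * sqrt (det g p)); [|lra].
transitivity (partial i (fun q => sqrt (det g q)) p * sqrt (det g p) +
  sqrt (det g p) * partial i (fun q => sqrt (det g q)) p); [ring|].
rewrite <- E. rewrite <- Rmult_assoc, (Rmult_assoc 2), <- sq. unfold det. rewrite sym. ring.
Qed.

(** The area form is parallel: the derivative of its density is a trace of Christoffel symbols,
    exactly what the connection terms of the two arguments contribute. *)
Lemma partial_area (a b : plane) (g : metric) (A B : field) (i : ix) (p : plane) :
  riemannian a b g -> smooth_field A -> smooth_field B ->
  partial i (fun q => area g q (A q) (B q)) p =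
  area g p (covariant g A i p) (B p) + area g p (A p) (covariant g B i p).
Proof.
intros hg hA hB. assert (Hv := smooth_vol a b g hg). unfold area.
rewrite partial_mult, partial_minus, !partial_mult by smoothness.
rewrite (partial_vol a b g i p hg). unfold covariant. rewrite !coord_vec. unfold sum2. ring.
Qed.

Lemma partial_inner (a b : plane) (g : metric) (A B : field) (i : ix) (p : plane) :
  riemannian a b g -> smooth_field A -> smooth_field B ->
  partial i (fun q => inner g q (A q) (B q)) p =
  inner g p (covariant g A i p) (B p) + inner g p (A p) (covariant g B i p).
Proof.
intros hg hA hB. assert (H := fun i j => smooth_metric a b g i j hg). unfold inner, sum2.
rewrite !partial_plus, !partial_mult by smoothness.
rewrite !(christoffel_metric a b g _ _ _ p hg).
unfold covariant. rewrite !coord_vec. unfold sum2.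
rewrite (proj1 (proj2 (proj2 hg)) I2 I1 p). ring.
Qed.

(** Leibniz's rule with all Christoffel symbols kept inside [covariant], so that in the curvature
    the derivatives of the direction fields cancel formally against the bracket. *)
Lemma covariant_nabla (a b : plane) (g : metric) (Y Z : field) (m k : ix) (p : plane) :
  riemannian a b g -> smooth_field Y -> smooth_field Z ->
  coord k (covariant g (nabla g Y Z) m p) =
  sum2 (fun n => partial m (fun q => coord n (Y q)) p * coord k (covariant g Z n p) +
    coord n (Y p) * coord k (covariant g (covariant g Z n) m p)).
Proof.
intros hg hY hZ. assert (H := fun n => smooth_covariant a b g Z n hg hZ).
unfold covariant at 1. rewrite coord_vec.
rewrite (partial_ext m _ _ p (fun q => coord_nabla g Y Z k q)).
unfold sum2. rewrite !coord_nabla. unfold sum2.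
rewrite partial_plus, !partial_mult by (smoothness; apply H).
assert (E : forall n, coord k (covariant g (covariant g Z n) m p) =
  partial m (fun q => coord k (covariant g Z n q)) p +
  sum2 (fun j => christoffel g k m j p * coord j (covariant g Z n p))).
{ intros n. unfold covariant at 1. apply coord_vec. }
rewrite !E. unfold sum2. ring.
Qed.

(* The components of R(d/dx, d/dy) Z: since [d/dx, d/dy] = 0 there is no bracket
   term, and curvature g X Y Z is cross X Y times this field. *)
Definition riem (g : metric) (Z : field) (k : ix) (p : plane) : R :=
  coord k (covariant g (covariant g Z I2) I1 p) -
  coord k (covariant g (covariant g Z I1) I2 p).

(** Once the derivatives of [X] and [Y] have cancelled, antisymmetry in two dimensions leaves a
    single component. The cross product is written through [area] because the connection form is an
    [area] too. *)
Lemma coord_curvature (a b : plane) (g : metric) (X Y Z : field) (k : ix) (p : plane) :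
  riemannian a b g -> smooth_field X -> smooth_field Y -> smooth_field Z ->
  coord k (curvature g X Y Z p) = area g p (X p) (Y p) / sqrt (det g p) * riem g Z k p.
Proof.
intros hg hX hY hZ.
assert (pos : 0 < sqrt (det g p)) by (apply sqrt_lt_R0, (det_pos a b g p hg)).
transitivity (coord k (nabla g X (nabla g Y Z) p) - coord k (nabla g Y (nabla g X Z) p) -
  coord k (nabla g (lie_bracket X Y) Z p)); [now destruct k|].
rewrite !coord_nabla. unfold sum2. rewrite !(covariant_nabla a b) by assumption.
unfold lie_bracket. rewrite !coord_vec. unfold sum2, riem, area. field. lra.
Qed.

(** * The bienergy density as a quadratic form in the connection form *)

Definition along (g : metric) (i : ix) (w : ix -> plane -> R) (p : plane) : R :=
  sum2 (fun j => coord j (frame g i p) * w j p).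

(* Minus the divergence of the 1-form w. *)
Definition codiff (g : metric) (w : ix -> plane -> R) (p : plane) : R :=
  sum2 (fun i =>
    sum2 (fun j => coord j (nabla g (frame g i) (frame g i) p) * w j p) -
    sum2 (fun k => coord k (frame g i p) * partial k (along g i w) p)).

(* The linear operator with S(V) = curv_sharp (conn V). *)
Definition curv_sharp (g : metric) (w : ix -> plane -> R) : field := fun p =>
  vec (fun k => sum2 (fun i =>
    - riem g (frame g i) k p / sqrt (det g p) * along g i w p)).

(** Polarised, so that the two arguments can be differentiated separately. For a unit field [V] the
    diagonal value at [conn g V] is the integrand of E_2 without the factor 1/2, volume weight
    included. *)
Definition energy_form (a b : plane) (g : metric) (v w : ix -> plane -> R) (p : plane) : R :=
  (inner g p (curv_sharp g v p) (curv_sharp g w p) + codiff g v p * codiff g w p) *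
  (sqrt (det g p) * Rabs (cross a b)).

(* The 1-form alpha with nabla_k V = alpha_k J V when V is a unit field. *)
Definition conn (g : metric) (V : field) (k : ix) (p : plane) : R :=
  area g p (V p) (covariant g V k p).

Lemma area_nabla (g : metric) (X Y : field) (u p : plane) :
  area g p u (nabla g X Y p) =
  sum2 (fun i => coord i (X p) * area g p u (covariant g Y i p)).
Proof. unfold area. rewrite !coord_nabla. unfold sum2. ring. Qed.

Lemma area_antisym (g : metric) (p u v : plane) : area g p u v = - area g p v u.
Proof. unfold area. ring. Qed.

(** The covector g(-, v) is nonzero and kills both [u] and [w]; in a plane its kernel is a line, so
    they are parallel. *)
Lemma area_perp (g : metric) (p u v w : plane) :
  inner g p v v = 1 -> inner g p u v = 0 -> inner g p w v = 0 -> area g p u w = 0.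
Proof.
unfold inner, area, sum2. intros h1 hu hw.
(* (n1, n2) are the components of that covector. Elimination gives c n1 = c n2 = 0, and pairing with
   [v] recovers c. *)
set (n1 := g I1 I1 p * coord I1 v + g I1 I2 p * coord I2 v) in *.
set (n2 := g I2 I1 p * coord I1 v + g I2 I2 p * coord I2 v) in *.
assert (eu : coord I1 u * n1 + coord I2 u * n2 = 0) by (rewrite <- hu; unfold n1, n2; ring).
assert (ew : coord I1 w * n1 + coord I2 w * n2 = 0) by (rewrite <- hw; unfold n1, n2; ring).
assert (e1 : coord I1 v * n1 + coord I2 v * n2 = 1) by (rewrite <- h1; unfold n1, n2; ring).
set (c := coord I1 u * coord I2 w - coord I2 u * coord I1 w).
assert (c1 : c * n1 = 0).
{ transitivity ((coord I1 u * n1 + coord I2 u * n2) * coord I2 w -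
    coord I2 u * (coord I1 w * n1 + coord I2 w * n2)); [unfold c; ring|].
  rewrite eu, ew; ring. }
assert (c2 : c * n2 = 0).
{ transitivity (coord I1 u * (coord I1 w * n1 + coord I2 w * n2) -
    (coord I1 u * n1 + coord I2 u * n2) * coord I1 w); [unfold c; ring|].
  rewrite eu, ew; ring. }
replace c with (coord I1 v * (c * n1) + coord I2 v * (c * n2)).
- rewrite c1, c2; ring.
- transitivity (c * (coord I1 v * n1 + coord I2 v * n2)); [ring|]. rewrite e1; ring.
Qed.

Lemma inner_sym (a b : plane) (g : metric) (p u v : plane) :
  riemannian a b g -> inner g p u v = inner g p v u.
Proof.
intros hg. unfold inner, sum2. rewrite (proj1 (proj2 (proj2 hg)) I2 I1 p). ring.
Qed.

(** Obtained by differentiating the constant g(V, V) = 1. *)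
Lemma inner_covariant (a b : plane) (g : metric) (V : field) (k : ix) (p : plane) :
  riemannian a b g -> unit_field a b g V -> inner g p (covariant g V k p) (V p) = 0.
Proof.
intros hg (hV & _ & h1).
assert (E := partial_inner a b g V V k p hg hV hV).
rewrite (partial_ext k _ (fun _ => 1) p h1), partial_const in E.
rewrite (inner_sym a b g p (V p)) in E by exact hg. lra.
Qed.

Lemma area_covariant (a b : plane) (g : metric) (V : field) (j k : ix) (p : plane) :
  riemannian a b g -> unit_field a b g V ->
  area g p (covariant g V j p) (covariant g V k p) = 0.
Proof.
intros hg hV. apply area_perp with (V p); [apply hV | |]; now apply (inner_covariant a b).
Qed.

(** The J V component of the Laplacian is all that E_2 retains. Differentiating alpha(e_i) = area(V,
    nabla_{e_i} V) puts the derivative on the second factor alone, since the other term is the area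
    of two vectors orthogonal to V. *)
Lemma area_rough_laplacian (a b : plane) (g : metric) (V : field) (p : plane) :
  riemannian a b g -> unit_field a b g V ->
  area g p (V p) (rough_laplacian g V p) = codiff g (conn g V) p.
Proof.
intros hg hV. assert (sV := proj1 hV).
assert (E : forall i k, area g p (V p) (covariant g (nabla g (frame g i) V) k p) =
  partial k (along g i (conn g V)) p).
{ intros i k.
  assert (sN := smooth_nabla a b g _ V hg (smooth_frame a b g i hg) sV).
  assert (P := partial_area a b g V _ k p hg sV sN).
  rewrite (partial_ext k _ (along g i (conn g V)) p) in P by (intros; apply area_nabla).
  rewrite P, area_nabla. unfold sum2. rewrite !(area_covariant a b) by assumption. ring. }
transitivity (sum2 (fun i => area g p (V p) (nabla g (nabla g (frame g i) (frame g i)) V p) -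
  area g p (V p) (nabla g (frame g i) (nabla g (frame g i) V) p))).
- unfold area, rough_laplacian, sum2. rewrite !coord_vec.
  assert (M : forall k u v, coord k (minus u v) = coord k u - coord k v) by now intros [].
  rewrite !M. ring.
- unfold codiff, sum2. rewrite !area_nabla. unfold sum2. rewrite !E. reflexivity.
Qed.

(** R(nabla_{e_i} V, V) e_i is area(nabla_{e_i} V, V) times a field that does not involve V;
    swapping the two arguments turns this factor into -alpha(e_i). *)
Lemma coord_S_field (a b : plane) (g : metric) (V : field) (k : ix) (p : plane) :
  riemannian a b g -> smooth_field V ->
  coord k (S_field g V p) = coord k (curv_sharp g (conn g V) p).
Proof.
intros hg sV. unfold S_field, curv_sharp. rewrite !coord_vec. unfold sum2.
rewrite !(coord_curvature a b) by
  (try apply (smooth_nabla a b); try apply (smooth_frame a b); assumption).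
rewrite !(area_antisym g p _ (V p)), !area_nabla. unfold along, conn, sum2, Rdiv. ring.
Qed.

Lemma inner_coord (g : metric) (p u v u' v' : plane) :
  (forall k, coord k u = coord k u') -> (forall k, coord k v = coord k v') ->
  inner g p u v = inner g p u' v'.
Proof. intros eu ev. unfold inner, sum2. now rewrite !eu, !ev. Qed.

(** Lagrange's identity |v|^2 |w|^2 - g(w, v)^2 = area(v, w)^2 with |v| = 1. With w the Laplacian it
    merges the last two terms of the integrand of E_2 into one square. *)
Lemma inner_lagrange (a b : plane) (g : metric) (p v w : plane) :
  riemannian a b g -> inner g p v v = 1 ->
  inner g p w w - inner g p w v ^ 2 = area g p v w * area g p v w.
Proof.
intros hg h1.
replace (inner g p w w) with (inner g p v v * inner g p w w) by (rewrite h1; ring).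
assert (sq := sqrt_sqrt _ (Rlt_le _ _ (proj2 (det_pos a b g p hg)))).
transitivity (sqrt (det g p) * sqrt (det g p) *
  (coord I1 v * coord I2 w - coord I2 v * coord I1 w) ^ 2); [|unfold area; ring].
rewrite sq. unfold inner, det, sum2. rewrite (proj1 (proj2 (proj2 hg)) I2 I1 p). ring.
Qed.

Lemma bienergy_conn (a b : plane) (g : metric) (V : field) :
  riemannian a b g -> unit_field a b g V ->
  bienergy a b g V =
  / 2 * fundamental_integral a b (energy_form a b g (conn g V) (conn g V)).
Proof.
intros hg hV. unfold bienergy. f_equal.
apply RInt_ext; intros s _; apply RInt_ext; intros r _.
generalize (comb a b s r); intros p. unfold energy_form.
rewrite <- (area_rough_laplacian a b g V p hg hV).
rewrite <- (inner_lagrange a b g p _ _ hg (proj2 (proj2 hV) p)).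
rewrite (inner_coord g p (S_field g V p) (S_field g V p)
  (curv_sharp g (conn g V) p) (curv_sharp g (conn g V) p))
  by (intros; now apply (coord_S_field a b), hV).
unfold Rminus. rewrite <- Rplus_assoc. apply Rmult_assoc.
Qed.

(** * Time-dependent 1-forms *)

(** The operators applied to time-dependent forms and fields are built from sums with
    time-independent coefficients; this lemma and the next carry the time variable through each of
    them. *)
Lemma smooth_comb (eps : R) (c : ix -> plane -> R) (F : ix -> R * plane -> R) :
  (forall j, smooth (c j)) -> (forall j, smooth_on (slab eps) (F j)) ->
  smooth_on (slab eps) (fun q : R * plane => sum2 (fun j => c j (snd q) * F j q)).
Proof.
intros hc hF. assert (H := fun j => smooth_space eps (c j) (hc j)).
unfold sum2. smoothness; apply H.
Qed.

Lemma dt_comb (eps : R) (c : ix -> plane -> R) (F : ix -> R * plane -> R) (q : R * plane) :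
  (forall j, smooth (c j)) -> (forall j, smooth_on (slab eps) (F j)) -> Rabs (fst q) < eps ->
  dt (fun q : R * plane => sum2 (fun j => c j (snd q) * F j q)) q =
  sum2 (fun j => c j (snd q) * dt (F j) q).
Proof.
intros hc hF hq. assert (H := fun j => smooth_space eps (c j) (hc j)).
assert (M : forall j, smooth_on (slab eps) (fun q : R * plane => c j (snd q) * F j q)).
{ intros j. apply (smooth_on_mult (E := spacetime)); auto using slab_open. }
unfold sum2. rewrite (dt_plus eps _ _ q (M I1) (M I2) hq).
rewrite !(dt_mult eps _ _ q (H _) (hF _) hq), !(dt_space (c _)). ring.
Qed.

(** [slice] evaluates at the rebuilt pair (fst q, snd q), which is not convertible to [q]. *)
Lemma smooth_eta (eps : R) (F : R * plane -> R) :
  smooth_on (slab eps) F -> smooth_on (slab eps) (fun q : R * plane => F (fst q, snd q)).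
Proof.
apply (smooth_on_ext (E := spacetime)); [apply slab_open | now intros []].
Qed.

Lemma dt_eta (F : R * plane -> R) (q : R * plane) : dt (fun q : R * plane => F (fst q, snd q)) q = dt F q.
Proof. apply Derive_ext. intros s. now destruct (plus _ _). Qed.

Definition slice (A : ix -> R * plane -> R) (t : R) (k : ix) (p : plane) : R := A k (t, p).

Lemma inner_ge0 (a b : plane) (g : metric) (p v : plane) :
  riemannian a b g -> 0 <= inner g p v v.
Proof.
intros (_ & _ & _ & pos). destruct v as [x y].
destruct (Req_dec x 0) as [->|n]; [destruct (Req_dec y 0) as [->|n]|].
- right. unfold inner, sum2, coord; simpl. ring.
- apply Rlt_le, pos. intros E; injection E; lra.
- apply Rlt_le, pos. intros E; injection E; lra.
Qed.

Section TimeDependent.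

Context (a b : plane) (g : metric) (hg : riemannian a b g) (eps : R).

Lemma smooth_along (A : ix -> R * plane -> R) (i : ix) :
  (forall k, smooth_on (slab eps) (A k)) ->
  smooth_on (slab eps) (fun q : R * plane => along g i (slice A (fst q)) (snd q)).
Proof.
intros hA. apply (smooth_comb eps (fun j p => coord j (frame g i p))
  (fun j (q : R * plane) => A j (fst q, snd q))).
- now apply (smooth_frame a b).
- intros j. now apply smooth_eta.
Qed.

Lemma dt_along (A : ix -> R * plane -> R) (i : ix) (q : R * plane) :
  (forall k, smooth_on (slab eps) (A k)) -> Rabs (fst q) < eps ->
  dt (fun q : R * plane => along g i (slice A (fst q)) (snd q)) q =
  along g i (slice (fun k => dt (A k)) (fst q)) (snd q).
Proof.
intros hA hq.
transitivity (sum2 (fun j => coord j (frame g i (snd q)) * dt (fun q : R * plane => A j (fst q, snd q)) q)).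
- apply (dt_comb eps (fun j p => coord j (frame g i p)) (fun j (q : R * plane) => A j (fst q, snd q)));
    auto using smooth_eta. now apply (smooth_frame a b).
- unfold along, slice, sum2. rewrite !(dt_eta (A _)). now destruct q.
Qed.

Lemma smooth_codiff (A : ix -> R * plane -> R) :
  (forall k, smooth_on (slab eps) (A k)) ->
  smooth_on (slab eps) (fun q : R * plane => codiff g (slice A (fst q)) (snd q)).
Proof.
intros hA.
assert (S1 : forall i, smooth_on (slab eps) (fun q : R * plane => sum2 (fun j =>
  coord j (nabla g (frame g i) (frame g i) (snd q)) * A j (fst q, snd q)))).
{ intros i. apply (smooth_comb eps (fun j p => coord j (nabla g (frame g i) (frame g i) p))
    (fun j (q : R * plane) => A j (fst q, snd q))).
  - apply (smooth_nabla a b); auto; now apply (smooth_frame a b).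
  - intros; now apply smooth_eta. }
assert (S2 : forall i, smooth_on (slab eps) (fun q : R * plane => sum2 (fun k =>
  coord k (frame g i (snd q)) * partial k (along g i (slice A (fst q))) (snd q)))).
{ intros i. apply (smooth_comb eps (fun k p => coord k (frame g i p))
    (fun k (q : R * plane) => partial k (along g i (slice A (fst q))) (snd q))).
  - now apply (smooth_frame a b).
  - intros k.
    apply (smooth_slice_partial eps k (fun q : R * plane => along g i (slice A (fst q)) (snd q))).
    now apply smooth_along. }
unfold codiff, sum2 at 1. apply (smooth_on_plus (E := spacetime)); [apply slab_open| |];
  apply (smooth_on_minus (E := spacetime)); auto using slab_open.
Qed.

(** [codiff] is a linear differential operator with time-independent coefficients; only the exchange
    of time and space derivatives has content. *)
Lemma dt_codiff (A : ix -> R * plane -> R) (q : R * plane) :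
  (forall k, smooth_on (slab eps) (A k)) -> Rabs (fst q) < eps ->
  dt (fun q : R * plane => codiff g (slice A (fst q)) (snd q)) q =
  codiff g (slice (fun k => dt (A k)) (fst q)) (snd q).
Proof.
intros hA hq.
assert (hE := fun i => smooth_frame a b g i hg).
assert (hN := fun i => smooth_nabla a b g _ _ hg (hE i) (hE i)).
set (P := fun i k (q : R * plane) => partial k (along g i (slice A (fst q))) (snd q)).
assert (hP : forall i k, smooth_on (slab eps) (P i k)).
{ intros i k.
  apply (smooth_slice_partial eps k (fun q : R * plane => along g i (slice A (fst q)) (snd q))).
  now apply smooth_along. }
(* The minus sign goes into the coefficients, so that the whole operator is a sum of terms covered
   by [dt_comb]. *)
set (c := fun i k p => - coord k (frame g i p)).
assert (hc : forall i k, smooth (c i k)).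
{ intros i k. apply (smooth_on_opp (E := plane_module)); [apply open_true | apply hE]. }
set (U := fun i (q : R * plane) => sum2 (fun j =>
  coord j (nabla g (frame g i) (frame g i) (snd q)) * A j (fst q, snd q))).
set (W := fun i (q : R * plane) => sum2 (fun k => c i k (snd q) * P i k q)).
assert (hA' := fun k => smooth_eta eps (A k) (hA k)).
assert (hU : forall i, smooth_on (slab eps) (U i)).
{ intros i. exact (smooth_comb eps (fun j p => coord j (nabla g (frame g i) (frame g i) p))
    (fun j (q : R * plane) => A j (fst q, snd q)) (hN i) hA'). }
assert (hW : forall i, smooth_on (slab eps) (W i)).
{ intros i. exact (smooth_comb eps (c i) (P i) (hc i) (hP i)). }
assert (hUW : forall i, smooth_on (slab eps) (fun q : R * plane => U i q + W i q)).
{ intros i. apply (smooth_on_plus (E := spacetime)); auto using slab_open. }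
transitivity (dt (fun q : R * plane => (U I1 q + W I1 q) + (U I2 q + W I2 q)) q).
{ apply Derive_ext. intros s. generalize (plus q (scal s (1, (0, 0)))). intros r.
  unfold codiff, U, W, c, P, sum2, slice. ring. }
rewrite (dt_plus eps _ _ q (hUW I1) (hUW I2) hq), !(dt_plus eps _ _ q (hU _) (hW _) hq).
assert (dU : forall i, dt (U i) q = sum2 (fun j =>
  coord j (nabla g (frame g i) (frame g i) (snd q)) * dt (A j) q)).
{ intros i. unfold U.
  rewrite (dt_comb eps (fun j p => coord j (nabla g (frame g i) (frame g i) p))
    (fun j (q : R * plane) => A j (fst q, snd q)) q (hN i) hA' hq).
  unfold sum2. now rewrite !(dt_eta (A _)). }
assert (dW : forall i, dt (W i) q = sum2 (fun k => c i k (snd q) *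
  partial k (along g i (slice (fun k => dt (A k)) (fst q))) (snd q))).
{ intros i. unfold W. rewrite (dt_comb eps (c i) (P i) q (hc i) (hP i) hq).
  assert (E : forall k, dt (P i k) q =
    partial k (along g i (slice (fun k => dt (A k)) (fst q))) (snd q)).
  { intros k. destruct q as [t p]. unfold P.
    refine (eq_trans (dt_partial eps k
      (fun q : R * plane => along g i (slice A (fst q)) (snd q)) t p _ hq) _);
      [now apply smooth_along|].
    apply partial_ext. intros p'. now apply (dt_along A i (t, p')). }
  unfold sum2. now rewrite !E. }
rewrite !dU, !dW. unfold codiff, c, sum2, slice. destruct q as [t p]; simpl fst; simpl snd.
ring.
Qed.

Lemma smooth_riem (i k : ix) : smooth (fun p => - riem g (frame g i) k p / sqrt (det g p)).
Proof.
assert (hE := smooth_frame a b g i hg).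
assert (hC := fun j => smooth_covariant a b g _ j hg hE).
assert (hD := fun j m => smooth_covariant a b g _ m hg (hC j)).
apply (smooth_on_div (E := plane_module)).
- apply open_true.
- intros p _. apply Rgt_not_eq, sqrt_lt_R0, (det_pos a b g p hg).
- apply smooth_on_opp; [apply open_true|].
  apply (smooth_on_minus (E := plane_module)); [apply open_true | apply hD | apply hD].
- now apply (smooth_vol a b).
Qed.

Lemma smooth_curv_sharp (A : ix -> R * plane -> R) (k : ix) :
  (forall k, smooth_on (slab eps) (A k)) ->
  smooth_on (slab eps) (fun q : R * plane => coord k (curv_sharp g (slice A (fst q)) (snd q))).
Proof.
intros hA. apply (smooth_on_ext (E := spacetime)) with
  (fun q : R * plane => sum2 (fun i => - riem g (frame g i) k (snd q) / sqrt (det g (snd q)) *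
    along g i (slice A (fst q)) (snd q))).
- apply slab_open.
- intros q _. symmetry. apply coord_vec.
- apply (smooth_comb eps (fun i p => - riem g (frame g i) k p / sqrt (det g p))
    (fun i (q : R * plane) => along g i (slice A (fst q)) (snd q))).
  + intros i. apply smooth_riem.
  + intros i. now apply smooth_along.
Qed.

Lemma dt_curv_sharp (A : ix -> R * plane -> R) (k : ix) (q : R * plane) :
  (forall k, smooth_on (slab eps) (A k)) -> Rabs (fst q) < eps ->
  dt (fun q : R * plane => coord k (curv_sharp g (slice A (fst q)) (snd q))) q =
  coord k (curv_sharp g (slice (fun k => dt (A k)) (fst q)) (snd q)).
Proof.
intros hA hq. unfold curv_sharp at 2. rewrite coord_vec.
transitivity (dt (fun q : R * plane => sum2 (fun i => - riem g (frame g i) k (snd q) / sqrt (det g (snd q)) *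
    along g i (slice A (fst q)) (snd q))) q).
{ apply Derive_ext. intros s. apply coord_vec. }
rewrite (dt_comb eps (fun i p => - riem g (frame g i) k p / sqrt (det g p))
    (fun i (q : R * plane) => along g i (slice A (fst q)) (snd q))).
- unfold sum2. now rewrite !(dt_along A).
- intros i. apply smooth_riem.
- intros i. now apply smooth_along.
- exact hq.
Qed.

Lemma smooth_energy_form (A B : ix -> R * plane -> R) :
  (forall k, smooth_on (slab eps) (A k)) -> (forall k, smooth_on (slab eps) (B k)) ->
  smooth_on (slab eps) (fun q : R * plane => energy_form a b g (slice A (fst q)) (slice B (fst q)) (snd q)).
Proof.
intros hA hB.
assert (cA := smooth_codiff A hA). assert (cB := smooth_codiff B hB).
assert (sA := fun k => smooth_curv_sharp A k hA). assert (sB := fun k => smooth_curv_sharp B k hB).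
assert (hG := fun i j => smooth_space eps _ (smooth_metric a b g i j hg)).
assert (hv := smooth_space eps _ (smooth_vol a b g hg)).
unfold energy_form, inner, sum2. smoothness.
Qed.

Lemma dt_energy_form (A B : ix -> R * plane -> R) (q : R * plane) :
  (forall k, smooth_on (slab eps) (A k)) -> (forall k, smooth_on (slab eps) (B k)) ->
  Rabs (fst q) < eps ->
  dt (fun q : R * plane => energy_form a b g (slice A (fst q)) (slice B (fst q)) (snd q)) q =
  energy_form a b g (slice (fun k => dt (A k)) (fst q)) (slice B (fst q)) (snd q) +
  energy_form a b g (slice A (fst q)) (slice (fun k => dt (B k)) (fst q)) (snd q).
Proof.
intros hA hB hq.
assert (cA := smooth_codiff A hA). assert (cB := smooth_codiff B hB).
assert (sA := fun k => smooth_curv_sharp A k hA). assert (sB := fun k => smooth_curv_sharp B k hB).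
assert (hG := fun i j => smooth_space eps _ (smooth_metric a b g i j hg)).
assert (hv := smooth_space eps _ (smooth_vol a b g hg)).
unfold energy_form, inner, sum2.
assert (hw : smooth_on (slab eps) (fun q : R * plane => sqrt (det g (snd q)) * Rabs (cross a b))) by smoothness.
rewrite (dt_mult eps _ (fun q : R * plane => sqrt (det g (snd q)) * Rabs (cross a b)))
  by (first [exact hq | smoothness]).
rewrite (dt_space (fun p => sqrt (det g p) * Rabs (cross a b))).
repeat first [rewrite (dt_plus eps) by (first [exact hq | smoothness])
  | rewrite (dt_mult eps _ (fun q : R * plane => coord _ (curv_sharp _ _ _))) by (first [exact hq | smoothness])
  | rewrite (dt_mult eps (fun q : R * plane => g _ _ _)) by (first [exact hq | smoothness])
  | rewrite (dt_mult eps (fun q : R * plane => codiff _ _ _)) by (first [exact hq | smoothness])].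
rewrite !(dt_space (g _ _)).
rewrite !(dt_codiff A), !(dt_codiff B), !(dt_curv_sharp A), !(dt_curv_sharp B) by assumption.
ring.
Qed.

Lemma energy_form_sym (v w : ix -> plane -> R) (p : plane) :
  energy_form a b g v w p = energy_form a b g w v p.
Proof. unfold energy_form. rewrite (inner_sym a b) by exact hg. ring. Qed.

(** A squared length plus a squared divergence, times a nonnegative weight: the source of the sign
    of the Hessian. *)
Lemma energy_form_ge0 (w : ix -> plane -> R) (p : plane) : 0 <= energy_form a b g w w p.
Proof.
unfold energy_form. apply Rmult_le_pos.
- apply Rplus_le_le_0_compat; [|apply Rle_0_sqr].
  apply (inner_ge0 a b); exact hg.
- apply Rmult_le_pos; [apply sqrt_pos | apply Rabs_pos].
Qed.

End TimeDependent.

(** * Variations of unit vector fields *)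

Definition smooth_family (eps : R) (U : R -> field) : Prop :=
  forall i, smooth_on (slab eps) (fun q : R * plane => coord i (U (fst q) (snd q))).

Definition velocity (U : R -> field) (t : R) : field := fun p =>
  vec (fun k => dt (fun q => coord k (U (fst q) (snd q))) (t, p)).

Lemma smooth_family_slice (eps t : R) (U : R -> field) :
  smooth_family eps U -> Rabs t < eps -> smooth_field (U t).
Proof. intros hU ht i. exact (smooth_slice eps t _ ht (hU i)). Qed.

Lemma smooth_family_velocity (eps : R) (U : R -> field) :
  smooth_family eps U -> smooth_family eps (velocity U).
Proof.
intros hU i. apply (smooth_on_ext (E := spacetime)) with
  (dt (fun q => coord i (U (fst q) (snd q)))); [apply slab_open | |now apply smooth_dt].
intros [t p] _. symmetry. apply coord_vec.
Qed.

Lemma smooth_family_covariant (a b : plane) (g : metric) (eps : R) (U : R -> field) (j : ix) :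
  riemannian a b g -> smooth_family eps U ->
  smooth_family eps (fun t => covariant g (U t) j).
Proof.
intros hg hU k.
apply (smooth_on_ext (E := spacetime)) with (fun q : R * plane =>
  partial j (fun p => coord k (U (fst q) p)) (snd q) +
  sum2 (fun i => christoffel g k j i (snd q) * coord i (U (fst q) (snd q)))).
- apply slab_open.
- intros q _. symmetry. apply coord_vec.
- apply (smooth_on_plus (E := spacetime)); [apply slab_open | |].
  + exact (smooth_slice_partial eps j _ (hU k)).
  + apply (smooth_comb eps (christoffel g k j)); [|exact hU].
    intros i. now apply (smooth_christoffel a b).
Qed.

(** The Christoffel symbols do not depend on time, so only mixed partial derivatives have to be
    exchanged. *)
Lemma velocity_covariant (a b : plane) (g : metric) (eps : R) (U : R -> field) (j k : ix)
    (t : R) (p : plane) :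
  riemannian a b g -> smooth_family eps U -> Rabs t < eps ->
  coord k (velocity (fun t => covariant g (U t) j) t p) =
  coord k (covariant g (velocity U t) j p).
Proof.
intros hg hU ht. unfold velocity at 1. rewrite coord_vec.
assert (hC := fun i => smooth_christoffel a b g k j i hg).
transitivity (dt (fun q : R * plane =>
  partial j (fun p => coord k (U (fst q) p)) (snd q) +
  sum2 (fun i => christoffel g k j i (snd q) * coord i (U (fst q) (snd q)))) (t, p)).
{ apply Derive_ext. intros s. apply coord_vec. }
refine (eq_trans (dt_plus eps _ _ (t, p) (smooth_slice_partial eps j _ (hU k))
  (smooth_comb eps _ _ hC hU) ht) _).
refine (eq_trans (f_equal2 Rplus (dt_partial eps j _ t p (hU k) ht)
  (dt_comb eps _ _ (t, p) hC hU ht)) _).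
unfold covariant. rewrite coord_vec. f_equal.
apply partial_ext. intros q. unfold velocity. now rewrite coord_vec.
Qed.

Lemma smooth_family_area (a b : plane) (g : metric) (eps : R) (U W : R -> field) :
  riemannian a b g -> smooth_family eps U -> smooth_family eps W ->
  smooth_on (slab eps) (fun q : R * plane => area g (snd q) (U (fst q) (snd q)) (W (fst q) (snd q))).
Proof.
intros hg hU hW. assert (hv := smooth_space eps _ (smooth_vol a b g hg)).
unfold area. smoothness; first [apply hU | apply hW].
Qed.

Lemma dt_area (a b : plane) (g : metric) (eps : R) (U W : R -> field) (t : R) (p : plane) :
  riemannian a b g -> smooth_family eps U -> smooth_family eps W -> Rabs t < eps ->
  dt (fun q => area g (snd q) (U (fst q) (snd q)) (W (fst q) (snd q))) (t, p) =
  area g p (velocity U t p) (W t p) + area g p (U t p) (velocity W t p).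
Proof.
intros hg hU hW ht. assert (hv := smooth_space eps _ (smooth_vol a b g hg)).
assert (L : forall i j, dt (fun q => coord i (U (fst q) (snd q)) * coord j (W (fst q) (snd q))) (t, p) =
  coord i (velocity U t p) * coord j (W t p) + coord i (U t p) * coord j (velocity W t p)).
{ intros i j. refine (eq_trans (dt_mult eps _ _ (t, p) (hU i) (hW j) ht) _).
  unfold velocity. now rewrite !coord_vec. }
assert (SM : forall i j, smooth_on (slab eps)
  (fun q : R * plane => coord i (U (fst q) (snd q)) * coord j (W (fst q) (snd q)))).
{ intros i j. apply (smooth_on_mult (E := spacetime)); [apply slab_open | apply hU | apply hW]. }
assert (SN : smooth_on (slab eps)
  (fun q : R * plane => - (coord I2 (U (fst q) (snd q)) * coord I1 (W (fst q) (snd q))))).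
{ apply (smooth_on_opp (E := spacetime)); [apply slab_open | apply SM]. }
assert (SD : smooth_on (slab eps)
  (fun q : R * plane => coord I1 (U (fst q) (snd q)) * coord I2 (W (fst q) (snd q)) +
    - (coord I2 (U (fst q) (snd q)) * coord I1 (W (fst q) (snd q))))).
{ apply (smooth_on_plus (E := spacetime)); [apply slab_open | apply SM | apply SN]. }
refine (eq_trans (dt_mult eps _ _ (t, p) hv SD ht) _).
rewrite (dt_plus eps _ _ (t, p) (SM I1 I2) SN ht), dt_opp, !L, (dt_space (fun p => sqrt (det g p))).
unfold area; simpl fst; simpl snd. ring.
Qed.

Lemma dt_inner (a b : plane) (g : metric) (eps : R) (U : R -> field) (t : R) (p : plane) :
  riemannian a b g -> smooth_family eps U -> Rabs t < eps ->
  dt (fun q => inner g (snd q) (U (fst q) (snd q)) (U (fst q) (snd q))) (t, p) =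
  2 * inner g p (velocity U t p) (U t p).
Proof.
intros hg hU ht. assert (hG := fun i j => smooth_space eps _ (smooth_metric a b g i j hg)).
set (u := fun i (q : R * plane) => coord i (U (fst q) (snd q))).
assert (hu : forall i, smooth_on (slab eps) (u i)) by exact hU.
assert (L : forall i, coord i (velocity U t p) = dt (u i) (t, p)) by (intros; apply coord_vec).
assert (SM : forall i j, smooth_on (slab eps) (fun q : R * plane => g i j (snd q) * u i q * u j q)).
{ intros i j. smoothness. }
assert (D : forall i j, dt (fun q => g i j (snd q) * u i q * u j q) (t, p) =
  g i j p * (dt (u i) (t, p) * u j (t, p) + u i (t, p) * dt (u j) (t, p))).
{ intros i j.
  assert (S2 : smooth_on (slab eps) (fun q : R * plane => g i j (snd q) * u i q)) by smoothness.
  refine (eq_trans (dt_mult eps _ _ (t, p) S2 (hu j) ht) _).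
  rewrite (dt_mult eps _ _ (t, p) (hG i j) (hu i) ht), (dt_space (g i j)). simpl snd. ring. }
assert (S2 : forall i, smooth_on (slab eps) (fun q : R * plane =>
  g i I1 (snd q) * u i q * u I1 q + g i I2 (snd q) * u i q * u I2 q)).
{ intros i. apply (smooth_on_plus (E := spacetime)); [apply slab_open | apply SM | apply SM]. }
refine (eq_trans (dt_plus eps _ _ (t, p) (S2 I1) (S2 I2) ht) _).
rewrite !(dt_plus eps _ _ (t, p) (SM _ _) (SM _ _) ht), !D.
unfold inner, sum2. rewrite !L. unfold u; simpl fst; simpl snd.
rewrite (proj1 (proj2 (proj2 hg)) I2 I1 p). ring.
Qed.

Definition angular_speed (g : metric) (X : R -> field) (t : R) (p : plane) : R :=
  area g p (X t p) (velocity X t p).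

Lemma smooth_angular_speed (a b : plane) (g : metric) (eps : R) (X : R -> field) :
  riemannian a b g -> smooth_family eps X ->
  smooth_on (slab eps) (fun q : R * plane => angular_speed g X (fst q) (snd q)).
Proof.
intros hg hX. exact (smooth_family_area a b g eps X (velocity X) hg hX
  (smooth_family_velocity eps X hX)).
Qed.

Lemma smooth_conn (a b : plane) (g : metric) (eps : R) (X : R -> field) (k : ix) :
  riemannian a b g -> smooth_family eps X ->
  smooth_on (slab eps) (fun q : R * plane => conn g (X (fst q)) k (snd q)).
Proof.
intros hg hX. exact (smooth_family_area a b g eps X (fun t => covariant g (X t) k) hg hX
  (smooth_family_covariant a b g eps X k hg hX)).
Qed.

(* Both sides are area X (nabla_k X') plus a term area X' (nabla_k X), up to sign,
   which vanishes because X' and nabla_k X are orthogonal to X. *)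
Lemma dt_conn (a b : plane) (g : metric) (eps : R) (X : R -> field) (k : ix)
    (t : R) (p : plane) :
  riemannian a b g -> smooth_family eps X ->
  (forall t, Rabs t < eps -> unit_field a b g (X t)) -> Rabs t < eps ->
  dt (fun q => conn g (X (fst q)) k (snd q)) (t, p) = partial k (angular_speed g X t) p.
Proof.
intros hg hX uX ht.
assert (hC := smooth_family_covariant a b g eps X k hg hX).
assert (sX := smooth_family_slice eps t X hX ht).
assert (sD := smooth_family_slice eps t _ (smooth_family_velocity eps X hX) ht).
assert (Z : area g p (velocity X t p) (covariant g (X t) k p) = 0).
{ apply area_perp with (X t p).
  - now apply uX.
  - assert (E := dt_inner a b g eps X t p hg hX ht).
    rewrite (dt_ext eps _ (fun _ => 1) (t, p) ht) in E.
    + rewrite (dt_space (fun _ => 1)) in E. lra.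
    + intros q hq. now apply uX.
  - apply (inner_covariant a b); auto. }
refine (eq_trans (dt_area a b g eps X (fun t => covariant g (X t) k) t p hg hX hC ht) _).
refine (eq_trans _ (eq_sym (partial_area a b g (X t) (velocity X t) k p hg sX sD))).
rewrite (area_antisym g p (covariant g (X t) k p)), Z. unfold area.
rewrite !(velocity_covariant a b g eps) by assumption. ring.
Qed.

(** [codiff] differentiates its argument, so agreement at [p] alone would not suffice;
    extensionality replaces the forms themselves. *)
Lemma energy_form_ext (a b : plane) (g : metric) (v w v' w' : ix -> plane -> R) (p : plane) :
  (forall k p, v k p = v' k p) -> (forall k p, w k p = w' k p) ->
  energy_form a b g v w p = energy_form a b g v' w' p.
Proof.
intros ev ew.
assert (v = v') as -> by (do 2 (apply functional_extensionality; intros); apply ev).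
assert (w = w') as -> by (do 2 (apply functional_extensionality; intros); apply ew).
reflexivity.
Qed.

(** * First and second variation of the bienergy *)

Definition first_variation (a b : plane) (g : metric) (X : R -> field) (q : R * plane) : R :=
  energy_form a b g (conn g (X (fst q))) (fun k => partial k (angular_speed g X (fst q))) (snd q).

Lemma smooth_first_variation (a b : plane) (g : metric) (eps : R) (X : R -> field) :
  riemannian a b g -> smooth_family eps X ->
  smooth_on (slab eps) (first_variation a b g X).
Proof.
intros hg hX.
apply (smooth_energy_form a b g hg eps (fun k (q : R * plane) => conn g (X (fst q)) k (snd q))
  (fun k (q : R * plane) => partial k (angular_speed g X (fst q)) (snd q))).
- intros k. now apply (smooth_conn a b).
- intros k. apply (smooth_slice_partial eps k
    (fun q : R * plane => angular_speed g X (fst q) (snd q))).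
  now apply (smooth_angular_speed a b).
Qed.

Lemma is_derive_bienergy (a b : plane) (g : metric) (V : field) (eps : R) (X : R -> field)
    (t : R) :
  riemannian a b g -> unit_variation a b g V eps X -> Rabs t < eps ->
  is_derive (fun t => bienergy a b g (X t)) t
    (fundamental_integral a b (fun p => first_variation a b g X (t, p))).
Proof.
intros hg (hX & uX & _) ht. change (smooth_family eps X) in hX.
set (A := fun k (q : R * plane) => conn g (X (fst q)) k (snd q)).
set (F := fun q : R * plane => energy_form a b g (slice A (fst q)) (slice A (fst q)) (snd q)).
assert (hA : forall k, smooth_on (slab eps) (A k)) by (intros k; now apply (smooth_conn a b)).
assert (hF : smooth_on (slab eps) F) by now apply smooth_energy_form.
apply is_derive_ext_loc with (fun t => / 2 * fundamental_integral a b (fun p => F (t, p))).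
{ apply filter_imp with (2 := locally_slab eps t ht). intros s hs. symmetry.
  now apply bienergy_conn; [|apply uX]. }
replace (fundamental_integral a b (fun p => first_variation a b g X (t, p))) with
  (/ 2 * fundamental_integral a b (fun p => dt F (t, p))).
{ apply (is_derive_scal (fun t => fundamental_integral a b (fun p => F (t, p)))).
  now apply is_derive_fundamental_integral with eps. }
assert (hI : smooth (fun p => first_variation a b g X (t, p))).
{ apply (smooth_slice eps t _ ht). now apply smooth_first_variation. }
(* Differentiating the quadratic form gives two terms that are equal by symmetry; the factor 1/2
   absorbs the doubling. *)
rewrite (fundamental_integral_ext a b _ (fun p =>
  first_variation a b g X (t, p) + first_variation a b g X (t, p))).
- rewrite fundamental_integral_plus by exact hI. field.
- intros p. unfold F. rewrite (dt_energy_form a b g hg eps A A (t, p) hA hA ht).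
  rewrite (energy_form_sym a b g hg (slice _ _)).
  assert (E : energy_form a b g (slice A t) (slice (fun k => dt (A k)) t) p =
    first_variation a b g X (t, p)).
  { apply energy_form_ext; [reflexivity|]. intros k p'. now apply (dt_conn a b g eps). }
  simpl fst; simpl snd. now rewrite E.
Qed.

Lemma dt_first_variation (a b : plane) (g : metric) (V : field) (eps : R) (X : R -> field)
    (t : R) (p : plane) :
  riemannian a b g -> unit_variation a b g V eps X -> Rabs t < eps ->
  dt (first_variation a b g X) (t, p) =
  energy_form a b g (fun k => partial k (angular_speed g X t))
    (fun k => partial k (angular_speed g X t)) p +
  energy_form a b g (conn g (X t))
    (fun k => partial k (fun p => dt (fun q => angular_speed g X (fst q) (snd q)) (t, p))) p.
Proof.
intros hg (hX & uX & _) ht. change (smooth_family eps X) in hX.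
set (A := fun k (q : R * plane) => conn g (X (fst q)) k (snd q)).
set (B := fun k (q : R * plane) => partial k (angular_speed g X (fst q)) (snd q)).
assert (hA : forall k, smooth_on (slab eps) (A k)) by (intros k; now apply (smooth_conn a b)).
assert (hS := smooth_angular_speed a b g eps X hg hX).
assert (hB : forall k, smooth_on (slab eps) (B k)).
{ intros k. exact (smooth_slice_partial eps k _ hS). }
refine (eq_trans (dt_energy_form a b g hg eps A B (t, p) hA hB ht) _).
apply f_equal2; apply energy_form_ext; intros k p'.
- now apply (dt_conn a b g eps).
- reflexivity.
- reflexivity.
- exact (dt_partial eps k _ t p' hS ht).
Qed.

(** * Rotating a field by a given angle *)

(** The quarter turn J V: the index of V is lowered with [g] and the result contracted with the
    inverse area form. The signs make V, J V positively oriented for [area]. *)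
Definition rotate (g : metric) (V : field) : field := fun p =>
  (- (g I2 I1 p * coord I1 (V p) + g I2 I2 p * coord I2 (V p)) / sqrt (det g p),
   (g I1 I1 p * coord I1 (V p) + g I1 I2 p * coord I2 (V p)) / sqrt (det g p)).

(** The angle [t * f] is a global function, so for periodic [f] and [V] this descends to the torus
    even when the angle of [V] itself has no periodic lift. *)
Definition rotation (g : metric) (V : field) (f : plane -> R) (t : R) : field := fun p =>
  vec (fun k => cos (t * f p) * coord k (V p) + sin (t * f p) * coord k (rotate g V p)).

Lemma smooth_rotate (a b : plane) (g : metric) (V : field) :
  riemannian a b g -> smooth_field V -> smooth_field (rotate g V).
Proof.
intros hg hV. assert (H := fun i j => smooth_metric a b g i j hg).
assert (N : forall p : plane, True -> sqrt (det g p) <> 0).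
{ intros p _. apply Rgt_not_eq, sqrt_lt_R0, (det_pos a b g p hg). }
assert (hv := smooth_vol a b g hg).
intros []; apply (smooth_on_div (E := plane_module)); smoothness.
Qed.

Lemma rotate_orthonormal (a b : plane) (g : metric) (V : field) (p : plane) :
  riemannian a b g -> inner g p (V p) (V p) = 1 ->
  inner g p (rotate g V p) (rotate g V p) = 1 /\ inner g p (V p) (rotate g V p) = 0 /\
  area g p (V p) (rotate g V p) = 1.
Proof.
intros hg h1. destruct (det_pos a b g p hg) as [_ hd].
assert (pos := sqrt_lt_R0 _ hd). assert (sq := sqrt_sqrt _ (Rlt_le _ _ hd)).
assert (sym := proj1 (proj2 (proj2 hg)) I2 I1 p).
unfold inner, sum2, area, rotate in *. simpl coord in *.
set (s := sqrt (det g p)) in *. unfold det in sq. rewrite sym in *.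
repeat split.
- rewrite <- h1.
  set (x := fst (V p)) in *; set (y := snd (V p)) in *.
  transitivity ((g I1 I1 p * g I2 I2 p - g I1 I2 p * g I1 I2 p) / (s * s) *
    (g I1 I1 p * x * x + g I1 I2 p * x * y + (g I1 I2 p * y * x + g I2 I2 p * y * y))).
  + field. lra.
  + rewrite <- sq. field. lra.
- field. lra.
- rewrite <- h1. field. lra.
Qed.

Lemma smooth_rotation (a b : plane) (g : metric) (V : field) (f : plane -> R) (eps : R) :
  riemannian a b g -> smooth_field V -> smooth f -> smooth_family eps (rotation g V f).
Proof.
intros hg hV hf k. assert (hR := smooth_rotate a b g V hg hV).
assert (hT : smooth_on (slab eps) (fun q : R * plane => fst q)).
{ apply (smooth_on_linear (E := spacetime)).
  - apply slab_open.
  - intros [t p]. exact (continuous_fst (U := R_UniformSpace)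
      (V := NormedModule.UniformSpace R_AbsRing plane_module) t p).
  - reflexivity. }
assert (hP : smooth_on (slab eps) (fun q : R * plane => fst q * f (snd q))).
{ apply (smooth_on_mult (E := spacetime)); auto using slab_open, smooth_space. }
assert (hc : smooth_on (slab eps) (fun q : R * plane => cos (fst q * f (snd q)))).
{ apply (smooth_on_cos (E := spacetime)); auto using slab_open. }
assert (hs : smooth_on (slab eps) (fun q : R * plane => sin (fst q * f (snd q)))).
{ apply (smooth_on_sin (E := spacetime)); auto using slab_open. }
assert (h1 := smooth_space eps _ (hV k)). assert (h2 := smooth_space eps _ (hR k)).
apply (smooth_on_ext (E := spacetime)) with (fun q : R * plane =>
  cos (fst q * f (snd q)) * coord k (V (snd q)) +
  sin (fst q * f (snd q)) * coord k (rotate g V (snd q))).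
- apply slab_open.
- intros q _. symmetry. apply coord_vec.
- smoothness.
Qed.

Lemma unit_variation_rotation (a b : plane) (g : metric) (V : field) (f : plane -> R) (eps : R) :
  riemannian a b g -> unit_field a b g V -> smooth f -> periodic a b f -> 0 < eps ->
  unit_variation a b g V eps (rotation g V f).
Proof.
intros hg (hV & pV & uV) hf pf he.
assert (hR := smooth_rotation a b g V f eps hg hV hf).
split; [exact hR | split].
- intros t ht. split; [now apply smooth_family_slice with eps | split].
  + intros v p hv. unfold rotation, rotate, det.
    rewrite (pV v p hv), (pf v p hv), !(proj1 (proj2 hg) _ _ v p hv). reflexivity.
  + intros p. destruct (rotate_orthonormal a b g V p hg (uV p)) as (e1 & e2 & _).
    transitivity (cos (t * f p) ^ 2 * inner g p (V p) (V p) +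
      2 * (cos (t * f p) * sin (t * f p)) * inner g p (V p) (rotate g V p) +
      sin (t * f p) ^ 2 * inner g p (rotate g V p) (rotate g V p)).
    * unfold inner, rotation, sum2. rewrite !coord_vec.
      rewrite (proj1 (proj2 (proj2 hg)) I2 I1 p). ring.
    * rewrite e1, e2, uV. assert (E := sin2_cos2 (t * f p)). unfold Rsqr in E. lra.
- intros p. unfold rotation. rewrite Rmult_0_l, cos_0, sin_0.
  destruct (V p) as [x y]; unfold vec; simpl coord. f_equal; ring.
Qed.

Lemma angular_speed_rotation (a b : plane) (g : metric) (V : field) (f : plane -> R) (p : plane) :
  riemannian a b g -> unit_field a b g V -> angular_speed g (rotation g V f) 0 p = f p.
Proof.
intros hg (_ & _ & uV).
destruct (rotate_orthonormal a b g V p hg (uV p)) as (_ & _ & e3).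
assert (E : forall k, coord k (velocity (rotation g V f) 0 p) = f p * coord k (rotate g V p)).
{ intros k. unfold velocity. rewrite coord_vec, <- Derive_dt. apply is_derive_unique.
  apply is_derive_ext with (fun t => cos (t * f p) * coord k (V p) +
    sin (t * f p) * coord k (rotate g V p)).
  { intros t. symmetry. apply coord_vec. }
  auto_derive; [exact I|]. rewrite Rmult_0_l, sin_0, cos_0. ring. }
assert (E0 : forall k, coord k (rotation g V f 0 p) = coord k (V p)).
{ intros k. unfold rotation. rewrite coord_vec, Rmult_0_l, cos_0, sin_0. ring. }
transitivity (f p * area g p (V p) (rotate g V p)); [|rewrite e3; ring].
unfold angular_speed, area. rewrite !E, !E0. ring.
Qed.

(** The Euler-Lagrange equation in weak form with test function [f]: criticality and
    [is_derive_bienergy] evaluate the same derivative, along the rotation of [V] by [t * f]. *)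
Lemma biharmonic_first_variation (a b : plane) (g : metric) (V : field) (f : plane -> R) :
  riemannian a b g -> biharmonic_unit a b g V -> smooth f -> periodic a b f ->
  fundamental_integral a b (energy_form a b g (conn g V) (fun k => partial k f)) = 0.
Proof.
intros hg [uV crit] hf pf.
(* The rotation exists for all times, so the radius 1 is an arbitrary choice. *)
assert (hY := unit_variation_rotation a b g V f 1 hg uV hf pf Rlt_0_1).
assert (h0 : Rabs 0 < 1) by (rewrite Rabs_R0; lra).
rewrite <- (is_derive_unique _ _ _ (crit 1 _ Rlt_0_1 hY)).
rewrite (is_derive_unique _ _ _ (is_derive_bienergy a b g V 1 _ 0 hg hY h0)).
apply fundamental_integral_ext. intros p. unfold first_variation. simpl fst; simpl snd.
assert (rotation g V f 0 = V) as -> by (apply functional_extensionality; apply hY).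
apply energy_form_ext; [reflexivity|]. intros k q. apply partial_ext. intros r.
symmetry. now apply (angular_speed_rotation a b).
Qed.

(** Qualifies phi' as a test function. Periodicity passes to time derivatives because it holds at
    all times near [t]. *)
Lemma periodic_dt_angular_speed (a b : plane) (g : metric) (V : field) (eps : R)
    (X : R -> field) (t : R) :
  riemannian a b g -> unit_variation a b g V eps X -> Rabs t < eps ->
  periodic a b (fun p => dt (fun q => angular_speed g X (fst q) (snd q)) (t, p)).
Proof.
intros hg (hX & uX & _) ht v p hv.
assert (P : forall t, Rabs t < eps ->
  angular_speed g X t (plus p v) = angular_speed g X t p).
{ clear t ht. intros t ht.
  assert (E : forall k, coord k (velocity X t (plus p v)) = coord k (velocity X t p)).
  { intros k. unfold velocity. rewrite !coord_vec, <- !Derive_dt. apply Derive_ext_loc.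
    apply filter_imp with (2 := locally_slab eps t ht). intros s hs. simpl fst; simpl snd.
    now rewrite (proj1 (proj2 (uX s hs)) v p hv). }
  unfold angular_speed, area. rewrite !E, (proj1 (proj2 (uX t ht)) v p hv).
  unfold det. now rewrite !(proj1 (proj2 hg) _ _ v p hv). }
rewrite <- !Derive_dt. apply Derive_ext_loc.
apply filter_imp with (2 := locally_slab eps t ht). intros s hs. now apply P.
Qed.

(** [Derive_n] is total and returns a value even where no derivative exists; the two existence
    clauses make the inequality a statement about a genuine second derivative. *)
Theorem theorem5p7 (a b : plane) (g : metric) (V : field)
    (hab : cross a b <> 0) (hg : riemannian a b g)
    (hV : biharmonic_unit a b g V)
    (eps : R) (heps : 0 < eps) (X : R -> field)
    (hX : unit_variation a b g V eps X) :
  locally 0 (fun t => ex_derive (fun t => bienergy a b g (X t)) t) /\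
  ex_derive_n (fun t => bienergy a b g (X t)) 2 0 /\
  0 <= Derive_n (fun t => bienergy a b g (X t)) 2 0.
Proof.
assert (h0 : Rabs 0 < eps) by now rewrite Rabs_R0.
assert (L := locally_slab eps 0 h0).
assert (D := fun t ht => is_derive_bienergy a b g V eps X t hg hX ht).
(* The angular acceleration phi' at time 0, the test function for criticality; [P] and [Q] are the
   two terms of the second variation. *)
set (f := fun p => dt (fun q => angular_speed g X (fst q) (snd q)) (0, p)).
set (P := energy_form a b g (fun k => partial k (angular_speed g X 0))
  (fun k => partial k (angular_speed g X 0))).
set (Q := energy_form a b g (conn g V) (fun k => partial k f)).
assert (sX := proj1 hX). change (smooth_family eps X) in sX.
assert (sphi := smooth_angular_speed a b g eps X hg sX).
assert (sf : smooth f) by (apply (smooth_slice eps 0 _ h0), smooth_dt, sphi).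
assert (D2 : is_derive (Derive (fun t => bienergy a b g (X t))) 0
  (fundamental_integral a b (fun p => P p + Q p))).
{ apply is_derive_ext_loc with
    (fun t => fundamental_integral a b (fun p => first_variation a b g X (t, p))).
  { apply filter_imp with (2 := L). intros t ht. symmetry. apply is_derive_unique, D, ht. }
  rewrite (fundamental_integral_ext a b _ (fun p => dt (first_variation a b g X) (0, p))).
  - apply is_derive_fundamental_integral with eps; [|exact h0].
    now apply smooth_first_variation.
  - intros p. rewrite (dt_first_variation a b g V eps) by assumption. unfold P, Q.
    assert (X 0 = V) as -> by (apply functional_extensionality; apply hX). reflexivity. }
split; [|split].
- apply filter_imp with (2 := L). intros t ht. eexists. apply D, ht.
- eexists. exact D2.
- change (0 <= Derive (Derive (fun t => bienergy a b g (X t))) 0).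
  rewrite (is_derive_unique _ _ _ D2).
  (* Smoothness at a fixed time follows from the space-time lemma for forms constant in time, sliced
     at 0. It allows the integral of [P + Q] to be split. *)
  assert (static : forall v w : ix -> plane -> R,
    (forall k, smooth (v k)) -> (forall k, smooth (w k)) -> smooth (energy_form a b g v w)).
  { intros v w hv hw.
    apply (smooth_slice eps 0 (fun q => energy_form a b g v w (snd q)) h0).
    apply (smooth_energy_form a b g hg eps (fun k q => v k (snd q)) (fun k q => w k (snd q)));
      intros; now apply smooth_space. }
  assert (dS : forall k, smooth (partial k (angular_speed g X 0))).
  { intros k. apply smooth_partial. exact (smooth_slice eps 0 _ h0 sphi). }
  assert (sP : smooth P) by now apply static.
  assert (sQ : smooth Q).
  { apply static.
    - intros k. assert (H := smooth_slice eps 0 _ h0 (smooth_conn a b g eps X k hg sX)).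
      assert (X 0 = V) as E by (apply functional_extensionality; apply hX).
      simpl in H. rewrite E in H. exact H.
    - intros k. now apply smooth_partial. }
  rewrite fundamental_integral_plus by assumption.
  unfold Q. rewrite (biharmonic_first_variation a b g V f hg hV sf).
  + rewrite Rplus_0_r. apply fundamental_integral_ge0; [exact sP|].
    intros p. apply (energy_form_ge0 a b g hg).
  + exact (periodic_dt_angular_speed a b g V eps X 0 hg hX h0).
Qed.
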